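(* Let $V,D,Q$, $h$, $P(z)$, $\widetilde A,\widetilde B,\widetilde C$ and $\widetilde F(y)=\widetilde A y^2-\widetilde B y+\widetilde C$ be as in the context, and let $\hat B_\infty$ be the matrix produced by Cyclic Reduction applied to $\widetilde A,\widetilde B,\widetilde C$. Partition $$\widetilde C=\begin{bmatrix} C_{11} & 0 \\ C_{21} & 0\end{bmatrix},\qquad \hat B_\infty=\begin{bmatrix} B_{11} & B_{12} \\ B_{21} & B_{22}\end{bmatrix},$$ where the bottom-right blocks have dimension $n_3\times n_3$ and correspond to the indices in $E_3$. Then $(Y,\begin{bmatrix}I&\Psi\end{bmatrix})$, with $$\Psi=-B_{12}B_{22}^{-1}\ge 0,\qquad Y=(C_{11}+\Psi C_{21})S^{-1}\ge 0,\qquad S:=B_{11}+\Psi B_{21},$$ is a subtraction-free expression for a d-stable left invariant pair of $\widetilde F(y)$, and $$(X,\begin{bmatrix}I&\Psi\end{bmatrix}),\qquad X=h^{-1}(Y-I),$$ is a subtraction-free expression for a c-stable left invariant pair of $P(z)$.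
   Context: Inequalities are componentwise; $\mathbf 1,\mathbf 0$ are the all-ones and all-zeros vectors. Data. $V=\mathrm{diag}(v_{ii})\ge 0$ and $D=\mathrm{diag}(d_{ii})$ are real diagonal $n\times n$ matrices and $Q\in\mathbb{R}^{n\times n}$ is a rate matrix ($Q_{ij}\ge0$ for $i\ne j$, $Q\mathbf 1=\mathbf 0$) such that: $Q$ is irreducible and aperiodic; $V\ne0$; there is no index $i$ with $v_{ii}=d_{ii}=0$. $P(z)=Vz^2-Dz+Q$. Let $E_1=\{i:v_{ii}>0\}$, $E_2=\{i:v_{ii}=0,d_{ii}>0\}$, $E_3=\{i:v_{ii}=0,d_{ii}<0\}$, $n_i=|E_i|$, and order indices so that, in blocks, $$V=\begin{bmatrix} V_1 & 0 & 0 \\ 0 & 0 & 0 \\ 0 & 0 & 0\end{bmatrix},\quad D=\begin{bmatrix} D_1 & 0 & 0 \\ 0 & D_2 & 0 \\ 0 & 0 & D_3\end{bmatrix},\quad Q=\begin{bmatrix} Q_{11} & Q_{12} & Q_{13} \\ Q_{21} & Q_{22} & Q_{23} \\ Q_{31} & Q_{32} & Q_{33}\end{bmatrix}.$$ $h>0$ is chosen small enough that the diagonals of $h^{-2}V_1+h^{-1}D_1+Q_{11}$ and $h^{-1}D_2+Q_{22}$ are nonnegative. Define $$\widetilde A=\begin{bmatrix} h^{-2}V_1 & 0 & 0 \\ 0 & 0 & 0 \\ 0 & 0 & -h^{-1}D_3\end{bmatrix},\quad \widetilde B=\begin{bmatrix} 2h^{-2}V_1+h^{-1}D_1 & 0 &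 -Q_{13} \\ 0 & h^{-1}D_2 & -Q_{23} \\ 0 & 0 & -h^{-1}D_3-Q_{33}\end{bmatrix},$$ $$\widetilde C=\begin{bmatrix} h^{-2}V_1+h^{-1}D_1+Q_{11} & Q_{12} & 0 \\ Q_{21} & h^{-1}D_2+Q_{22} & 0 \\ Q_{31} & Q_{32} & 0\end{bmatrix}.$$ These arise by substituting $z=(y-1)/h$ in $P(z)\,\mathrm{diag}(I,I,(1+hz)I)$, which has, besides the finite eigenvalues of $P$, $n_3$ additional eigenvalues $-h^{-1}$, mapped to $0$ by $y=1+hz$. Cyclic Reduction: $A_0=\widetilde A$, $B_0=\hat B_0=\widetilde B$, $C_0=\widetilde C$, and $A_{k+1}=A_kB_k^{-1}A_k$, $B_{k+1}=B_k-A_kB_k^{-1}C_k-C_kB_k^{-1}A_k$, $C_{k+1}=C_kB_k^{-1}C_k$, $\hat B_{k+1}=\hat B_k-C_kB_k^{-1}A_k$; $\hat B_\infty=\lim_k\hat B_k$ (known to exist and to be an invertible M-matrix). The matrix $R=\widetilde C\hat B_\infty^{-1}\ge 0$ satisfies $R^2\widetilde A-R\widetilde B+\widetilde C=0$. Invariant pairs. For a matrix polynomial $\sum_{i=0}^g P_iz^i\in\mathbb{C}[z]^{n\times n}$, a left invariant pair is $(X,U)\in\mathbb{C}^{\ell\times\ell}\times\mathbb{C}^{\ell\times n}$ with $\sum_{i=0}^gX^iUP_i=0$ and $\begin{bmatrix}U&XU&\cdots&X^{g-1}U\end{bmatrix}$ of full row rank; its associated eigenvalues are the eigenvalues of $X$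 (with multiplicity). The finite eigenvalues of a matrix polynomial are the roots of its determinant, with multiplicity. c-stable: let $\mathbf u>\mathbf 0$ be a row vector with $\mathbf uQ=\mathbf 0$ and $d=\mathbf uD\mathbf 1$. A left invariant pair of $P(z)$ is c-stable if its associated eigenvalues are: if $d<0$ (positive recurrent case), the $n_1+n_2$ eigenvalues of $P(z)$ with $\Re\lambda<0$; if $d\ge0$ (null recurrent or transient case), the $n_1+n_2-1$ eigenvalues with $\Re\lambda<0$ together with the eigenvalue $0$ with multiplicity 1. d-stable: note $\widetilde A-\widetilde B+\widetilde C=Q$, and let $d'=\mathbf u(\widetilde C-\widetilde A)\mathbf 1$. A left invariant pair of $\widetilde F(y)$ is d-stable if its associated eigenvalues are: if $d'<0$ (positive recurrent case), the $n$ eigenvalues of $\widetilde F(y)$ with $|\lambda|<1$; if $d'\ge 0$ (null recurrent or transient case), the $n-1$ eigenvalues with $|\lambda|<1$ together with the eigenvalue $1$ with multiplicity 1. An M-matrix is $M=sI-N$ with $N\ge0$, $s\ge\rho(N)$; a triplet representation of it is $(\mathrm{offdiag}(M),\mathbf v,\mathbf w)$ with $\mathbf v>\mathbf 0,\mathbf w\ge\mathbf 0$, $M\mathbf v=\mathbf w$, where $\mathrm{offdiag}(M)$ lists the off-diagonal entries. ''Subtraction-free expression'' means a formula which can be evaluated without ever subtracting two numbers of the same sign; inversion of a nonsingular M-matrix for which a triplet representation is available counts as subtraction-free (GTH algorithm), and for a matrix $X$ such that $-X$ is an M-matrix only the off-diagonal entries need be so computed (equivalently, $X$ is represented as $h^{-1}Y-h^{-1}I$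 with $Y\geq 0$). A triplet representation of $\hat B_\infty$ is available, namely $(\mathrm{offdiag}(\hat B_\infty),\mathbf 1,\widetilde A\mathbf 1+\lim_k C_k\mathbf 1)$.
   Formalization: As Y has only n1+n2 eigenvalues, the d-stable claim is false as written if n3>0; it is proved in the form: the eigenvalues of Y together with n3 zeros are the n eigenvalues of F̃ with |λ|<1 (or the n−1 such and 1). *)

(* Defs.v *)
From mathcomp Require Import all_boot all_order all_algebra.
From mathcomp Require Import reals topology normedtype sequences.
From mathcomp Require Export complex.

Set Implicit Arguments.
Unset Strict Implicit.
Unset Printing Implicit Defensive.

Import Order.TTheory GRing.Theory Num.Theory.
Import numFieldNormedType.Exports.

Local Open Scope ring_scope.

Definition mx_ge0 (R : numDomainType) m n (M : 'M[R]_(m, n)) : Prop :=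
  forall i j, 0 <= M i j.

Definition mx_gt0 (R : numDomainType) m n (M : 'M[R]_(m, n)) : Prop :=
  forall i j, 0 < M i j.

Definition ones (R : pzSemiRingType) n : 'cV[R]_n := const_mx 1.

Definition cplx_mx (R : realType) m n (M : 'M[R]_(m, n)) : 'M[R[i]]_(m, n) :=
  map_mx (real_complex R) M.

(* Entrywise, which is convergence of matrices of a fixed size. *)
Definition mx_lim (R : realType) m n (M : nat -> 'M[R]_(m, n)) : 'M[R]_(m, n) :=
  \matrix_(i, j) limn (fun k => M k i j).

Definition rate_matrix (R : numDomainType) n (Q : 'M[R]_n) : Prop :=
  (forall i j, i != j -> 0 <= Q i j) /\ Q *m ones R n = 0.

Section Digraph.
Variables (R : pzRingType) (n : nat) (M : 'M[R]_n).

Definition mx_rel : rel 'I_n := fun i j => M i j != 0.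

Definition mx_irreducible : Prop := forall i j, connect mx_rel i j.

Definition return_time (i : 'I_n) (k : nat) : Prop :=
  exists p : seq 'I_n, [/\ 0 < k, size p = k, path mx_rel i p & last i p = i]%N.

(* [d] is the greatest common divisor of the return times to [i]. *)
Definition mx_period (i : 'I_n) (d : nat) : Prop :=
  (forall k, return_time i k -> (d %| k)%N) /\
  (forall e, (forall k, return_time i k -> (e %| k)%N) -> (e %| d)%N).

(* The period of a state without return times is 0; this only concerns the
   one-state chain, whose generator is 0, and which is not periodic. *)
Definition mx_aperiodic : Prop := forall i d, mx_period i d -> (d <= 1)%N.

End Digraph.

Section Blocks.
Variables (R : nmodType) (n1 n2 n3 : nat).
Implicit Type M : 'M[R]_(n1 + n2 + n3).

Definition blk11 M : 'M_(n1, n1) := ulsubmx (ulsubmx M).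
Definition blk12 M : 'M_(n1, n2) := ursubmx (ulsubmx M).
Definition blk13 M : 'M_(n1, n3) := usubmx (ursubmx M).
Definition blk21 M : 'M_(n2, n1) := dlsubmx (ulsubmx M).
Definition blk22 M : 'M_(n2, n2) := drsubmx (ulsubmx M).
Definition blk23 M : 'M_(n2, n3) := dsubmx (ursubmx M).
Definition blk31 M : 'M_(n3, n1) := lsubmx (dlsubmx M).
Definition blk32 M : 'M_(n3, n2) := rsubmx (dlsubmx M).
Definition blk33 M : 'M_(n3, n3) := drsubmx M.

Definition block3_mx
    (M11 : 'M[R]_(n1, n1)) (M12 : 'M[R]_(n1, n2)) (M13 : 'M[R]_(n1, n3))
    (M21 : 'M[R]_(n2, n1)) (M22 : 'M[R]_(n2, n2)) (M23 : 'M[R]_(n2, n3))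
    (M31 : 'M[R]_(n3, n1)) (M32 : 'M[R]_(n3, n2)) (M33 : 'M[R]_(n3, n3)) :
    'M[R]_(n1 + n2 + n3) :=
  block_mx (block_mx M11 M12 M21 M22) (col_mx M13 M23) (row_mx M31 M32) M33.

End Blocks.

Section Brownian.
Variables (R : realType) (n1 n2 n3 : nat).
Variables (V D Q : 'M[R]_(n1 + n2 + n3)) (h : R).

Definition E1 : {set 'I_(n1 + n2 + n3)} := [set i | 0 < V i i].
Definition E2 : {set 'I_(n1 + n2 + n3)} := [set i | (V i i == 0) && (0 < D i i)].
Definition E3 : {set 'I_(n1 + n2 + n3)} := [set i | (V i i == 0) && (D i i < 0)].

Definition Atilde : 'M[R]_(n1 + n2 + n3) := block3_mx
  (h ^- 2 *: blk11 V) 0 0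
  0                   0 0
  0                   0 (- (h^-1 *: blk33 D)).

Definition Btilde : 'M[R]_(n1 + n2 + n3) := block3_mx
  (2 *: (h ^- 2 *: blk11 V) + h^-1 *: blk11 D) 0 (- blk13 Q)
  0 (h^-1 *: blk22 D)                            (- blk23 Q)
  0 0                       (- (h^-1 *: blk33 D) - blk33 Q).

Definition Ctilde : 'M[R]_(n1 + n2 + n3) := block3_mx
  (h ^- 2 *: blk11 V + h^-1 *: blk11 D + blk11 Q) (blk12 Q) 0
  (blk21 Q) (h^-1 *: blk22 D + blk22 Q)                     0
  (blk31 Q) (blk32 Q)                                       0.

End Brownian.

Section CyclicReduction.
Variables (R : realType) (n : nat).

Record cr_state := CRState {
  cr_A : 'M[R]_n; cr_B : 'M[R]_n; cr_C : 'M[R]_n; cr_Bhat : 'M[R]_n }.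

Definition cr_step (s : cr_state) : cr_state :=
  let: CRState A B C Bh := s in
  CRState (A *m invmx B *m A)
          (B - A *m invmx B *m C - C *m invmx B *m A)
          (C *m invmx B *m C)
          (Bh - C *m invmx B *m A).

Definition cyclic_reduction (A B C : 'M[R]_n) (k : nat) : cr_state :=
  iter k cr_step (CRState A B C B).

Definition Bhat_inf (A B C : 'M[R]_n) : 'M[R]_n :=
  mx_lim (fun k => cr_Bhat (cyclic_reduction A B C k)).

Definition Bhat_inf_w (A B C : 'M[R]_n) : 'cV[R]_n :=
  A *m ones R n + mx_lim (fun k => cr_C (cyclic_reduction A B C k) *m ones R n).

End CyclicReduction.

(* A matrix polynomial is given by its coefficients in increasing degree;
   its degree [g] is one less than the number of coefficients listed. *)
Section InvariantPairs.
Variables (R : realType) (n : nat).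
Local Notation C := (R[i]).
Implicit Type P : seq 'M[C]_n.

Definition mxpolynomial P : 'M[{poly C}]_n :=
  \sum_(i < size P) 'X^i *: map_mx polyC P`_i.

(* 0 when [z] is not a finite eigenvalue of [P]. *)
Definition finite_eig_mult P (z : C) : nat := mup z (\det (mxpolynomial P)).

Definition left_invariant_pair l P (X : 'M[C]_l) (U : 'M[C]_(l, n)) : Prop :=
  \sum_(i < size P) X ^+ i *m U *m P`_i = 0 /\
  row_free (\mxrow_(i < (size P).-1) (X ^+ i *m U)).

(* [s] is the list of the eigenvalues of [X], with multiplicity. *)
Definition eigenvalues_are l (X : 'M[C]_l) (s : seq C) : Prop :=
  char_poly X = \prod_(z <- s) ('X - z%:P).

(* Here [m] stands for n1 + n2 and [d] for u D 1. *)
Definition c_stable (m : nat) (d : R) l P (X : 'M[C]_l) (U : 'M[C]_(l, n)) :=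
  left_invariant_pair P X U /\
  exists s : seq C,
    [/\ size s = (if d < 0 then m else m.-1),
        forall z, count_mem z s =
                  (if complex.Re z < 0 then finite_eig_mult P z else 0%N)
      & eigenvalues_are X (if d < 0 then s else 0 :: s)].

(* The eigenvalues of [Y], together with [k] further eigenvalues 0, are the [n]
   eigenvalues of [P] in the open unit disk (or the [n - 1] ones and the simple
   eigenvalue 1).  With [k = 0] this is the plain notion, whose pairs have [n]
   rows.  A pair with n1 + n2 rows carries n1 + n2 eigenvalues only: there, [k] is
   n3, the number of eigenvalues 0 (h z = -1) brought in by the factor
   diag(I, I, (1 + h z) I).  [d] stands for u (C - A) 1. *)
Definition d_stable (k : nat) (d : R) l P (Y : 'M[C]_l) (U : 'M[C]_(l, n)) :=
  left_invariant_pair P Y U /\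
  exists s s' : seq C,
    [/\ size s = (if d < 0 then n else n.-1),
        forall z, count_mem z s =
                  (if `|z| < 1 then finite_eig_mult P z else 0%N),
        perm_eq (s' ++ nseq k 0) (if d < 0 then s else 1 :: s)
      & eigenvalues_are Y s'].

End InvariantPairs.

Section MMatrix.
Variables (R : realType) (n : nat).
Implicit Type M : 'M[R]_n.

Definition Mmatrix M : Prop :=
  exists (s : R) (N : 'M[R]_n),
    [/\ mx_ge0 N, M = s%:M - N
      & forall z : R[i], eigenvalue (cplx_mx N) z -> `|z| <= (s%:C)%C].

Definition triplet M (v w : 'cV[R]_n) : Prop :=
  [/\ mx_gt0 v, mx_ge0 w & M *m v = w].

End MMatrix.

(* Matrix formulas over a family [I] of typed inputs.  An inverse carries two
   further formulas, the vectors of a triplet representation of the inverted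
   matrix; they do not affect its value. *)
Inductive mexpr (I : nat -> nat -> Type) : nat -> nat -> Type :=
| MVar m n of I m n : mexpr I m n
| MId n : mexpr I n n
| MOnes n : mexpr I n 1
| MAdd m n of mexpr I m n & mexpr I m n : mexpr I m n
| MOpp m n of mexpr I m n : mexpr I m n
| MMul m n p of mexpr I m n & mexpr I n p : mexpr I m p
| MDiv m n of mexpr I m n & mexpr I 1 1 : mexpr I m n
| MInv n of mexpr I n n & mexpr I n 1 & mexpr I n 1 : mexpr I n n
| MRow m n1 n2 of mexpr I m n1 & mexpr I m n2 : mexpr I m (n1 + n2)
| MUsub m1 m2 n of mexpr I (m1 + m2) n : mexpr I m1 n
| MDsub m1 m2 n of mexpr I (m1 + m2) n : mexpr I m2 n
| MLsub m n1 n2 of mexpr I m (n1 + n2) : mexpr I m n1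
| MRsub m n1 n2 of mexpr I m (n1 + n2) : mexpr I m n2.

Arguments MVar {I m n}.
Arguments MId {I}.
Arguments MOnes {I}.

Section SubtractionFree.
Variables (R : realType) (I : nat -> nat -> Type).
Variable env : forall m n, I m n -> 'M[R]_(m, n).
(* [known x i j]: the entry (i, j) of the input [x] is available. *)
Variable known : forall m n, I m n -> 'I_m -> 'I_n -> bool.

Fixpoint meval m n (e : mexpr I m n) : 'M[R]_(m, n) :=
  match e in mexpr _ m n return 'M[R]_(m, n) with
  | MVar _ _ x => env x
  | MId n => 1%:M
  | MOnes n => ones R n
  | MAdd _ _ e f => meval e + meval f
  | MOpp _ _ e => - meval e
  | MMul _ _ _ e f => meval e *m meval f
  | MDiv _ _ e s => (meval s 0 0)^-1 *: meval e
  | MInv _ e _ _ => invmx (meval e)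
  | MRow _ _ _ e f => row_mx (meval e) (meval f)
  | MUsub _ _ _ e => usubmx (meval e)
  | MDsub _ _ _ e => dsubmx (meval e)
  | MLsub _ _ _ e => lsubmx (meval e)
  | MRsub _ _ _ e => rsubmx (meval e)
  end.

(* The entry (i, j) of [e] is computed without subtracting two numbers of the
   same sign, i.e. without adding two numbers of opposite signs.  The inverse of
   a nonsingular M-matrix only requires its off-diagonal entries and the vectors
   of a triplet representation. *)
Fixpoint subfree m n (e : mexpr I m n) : 'I_m -> 'I_n -> Prop :=
  match e in mexpr _ m n return 'I_m -> 'I_n -> Prop with
  | MVar _ _ x => fun i j => known x i j
  | MId n => fun _ _ => True
  | MOnes n => fun _ _ => True
  | MAdd _ _ e f => fun i j =>
      [/\ subfree e i j, subfree f i j & 0 <= meval e i j * meval f i j]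
  | MOpp _ _ e => subfree e
  | MMul _ _ _ e f => fun i j =>
      (forall k, subfree e i k /\ subfree f k j) /\
      (forall k l, 0 <= (meval e i k * meval f k j) * (meval e i l * meval f l j))
  | MDiv _ _ e s => fun i j =>
      [/\ subfree e i j, subfree s 0 0 & meval s 0 0 != 0]
  | MInv _ e v w => fun _ _ =>
      [/\ forall k l, k != l -> subfree e k l,
          forall k, subfree v k 0 /\ subfree w k 0,
          Mmatrix (meval e),
          meval e \in unitmx
        & triplet (meval e) (meval v) (meval w)]
  | MRow _ _ _ e f => fun i j =>
      match split j with inl j1 => subfree e i j1 | inr j2 => subfree f i j2 end
  | MUsub _ m2 _ e => fun i j => subfree e (lshift m2 i) j
  | MDsub m1 _ _ e => fun i j => subfree e (rshift m1 i) j
  | MLsub _ _ n2 e => fun i j => subfree e i (lshift n2 j)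
  | MRsub _ n1 _ e => fun i j => subfree e i (rshift n1 j)
  end.

Definition subfree_expr m n (e : mexpr I m n) (M : 'M[R]_(m, n)) : Prop :=
  meval e = M /\ forall i j, subfree e i j.

(* For the opposite of an M-matrix. *)
Definition subfree_offdiag_expr n (e : mexpr I n n) (M : 'M[R]_n) : Prop :=
  [/\ meval e = M, Mmatrix (- M) & forall i j, i != j -> subfree e i j].

End SubtractionFree.

(* The matrix [Bhat], with the third component [w] of its triplet representation
   (offdiag Bhat, 1, w), the matrix C and the scalar h. *)
Inductive cr_input (n : nat) : nat -> nat -> Type :=
| InBhat : cr_input n n n
| InW : cr_input n n 1
| InC : cr_input n n n
| InH : cr_input n 1 1.

Definition cr_env (R : realType) n (Bh : 'M[R]_n) (w : 'cV[R]_n) (C : 'M[R]_n)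
    (h : R) p q (x : cr_input n p q) : 'M[R]_(p, q) :=
  match x in cr_input _ p q return 'M[R]_(p, q) with
  | InBhat => Bh
  | InW => w
  | InC => C
  | InH => h%:M
  end.

Definition cr_known n p q (x : cr_input n p q) : 'I_p -> 'I_q -> bool :=
  match x in cr_input _ p q return 'I_p -> 'I_q -> bool with
  | InBhat => fun i j => i != j
  | _ => fun _ _ => true
  end.

(* The block formulas for Psi, S, Y, X and [I Psi]; [m] stands for n1 + n2.
   Triplets: B22 1 = w2 - B21 1 and S 1 = w1 + Psi w2. *)
Section Formulas.
Variables m n3 : nat.
Local Notation expr := (mexpr (cr_input (m + n3))).

Definition B11_e : expr m m := MLsub (MUsub (MVar (InBhat _))).
Definition B12_e : expr m n3 := MRsub (MUsub (MVar (InBhat _))).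
Definition B21_e : expr n3 m := MLsub (MDsub (MVar (InBhat _))).
Definition B22_e : expr n3 n3 := MRsub (MDsub (MVar (InBhat _))).
Definition C11_e : expr m m := MLsub (MUsub (MVar (InC _))).
Definition C21_e : expr n3 m := MLsub (MDsub (MVar (InC _))).
Definition w1_e : expr m 1 := MUsub (MVar (InW _)).
Definition w2_e : expr n3 1 := MDsub (MVar (InW _)).

Definition Psi_e : expr m n3 :=
  MOpp (MMul B12_e
    (MInv B22_e (MOnes n3) (MAdd w2_e (MOpp (MMul B21_e (MOnes m)))))).

Definition S_e : expr m m := MAdd B11_e (MMul Psi_e B21_e).

Definition Y_e : expr m m :=
  MMul (MAdd C11_e (MMul Psi_e C21_e))
       (MInv S_e (MOnes m) (MAdd w1_e (MMul Psi_e w2_e))).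

Definition X_e : expr m m := MDiv (MAdd Y_e (MOpp (MId m))) (MVar (InH _)).

Definition IPsi_e : expr m (m + n3) := MRow (MId m) Psi_e.

End Formulas.

(* Main.v *)
Require Import Defs.
From mathcomp Require Import all_boot all_order all_algebra.
From mathcomp Require Import boolp classical_sets reals topology normedtype sequences.
From mathcomp Require Import ring lra zify.

(** The matrices [A], [B], [C] are the blocks of a level-structured Markov process:
    [C] moves it one level up, [A] one level down, [- B] acts inside a level, and
    [A - B + C = Q] is the generator of the phases.

    Cyclic reduction.  Let [S_0 = B], [S_(m+1) = B - C S_m^-1 A] be the pivots of
    the elimination of the levels one after the other.  A step of cyclic reduction
    eliminates every other level, so that [Bhat_k] is the pivot of index
    [2 ^ k - 1] ([level_schur_double], [cyclic_reduction_Bhat]).  The pivots are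
    nonsingular M-matrices: their row sums are at least those of [A], which are
    positive outside E2, and their columns in E2 are those of [B], that is of a
    positive diagonal matrix ([level_matrix_nonsing]).  They decrease and are
    bounded below, and their inverses increase and are bounded above, so that the
    limit [L] exists, is again such a matrix and satisfies [L = B - C L^-1 A]
    ([level_schur_cvg]), whatever the sign of the drift.

    Spectrum.  With [R = C L^-1], the fixed-point equation gives the factorization
    [F(y) = (y - R) (y A - L)] ([rate_factorization]).  The matrix [A] is diagonal,
    hence [y A - L] is diagonally dominant as long as [Re y < 1] ([pencil_unit]):
    in that half-plane the eigenvalues of [F] are those of [R].  From [u C <= u L]
    one gets [u R <= u], so the eigenvalues of [R] have modulus at most [1].  An
    eigenvalue of modulus [1] is [1] itself ([rate_unit_circle]), because taking
    moduli in [w F(z) = 0] yields an element of the left kernel of [Q], which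
    irreducibility reduces to the multiples of [u], and at a phase where [A] is
    positive the inequality between moduli is strict for [z <> 1].  Finally
    [1] is an eigenvalue exactly when the drift [u (C - A) 1] is nonnegative, and it
    is then simple, [u] being a positive fixed vector ([rate_root1_neg],
    [rate_root1_ge0]).

    The pair.  With [U = [I Psi]] one has [U L = [S 0]], and since the last block
    column of [C] vanishes, [R = K U] and [Y = U K] for the same [K]; so [U R = Y U]
    and [R] has the eigenvalues of [Y] together with [n3] zeros.  This proves that
    [(Y, U)] is invariant and d-stable.  For [P], the substitution [z = (y - 1) / h]
    gives [det F(y) = det P(z) y ^ n3], so that the same factorization counts the
    eigenvalues with [Re z < 0], that is [Re y < 1] ([count_P]); in the columns of
    E3 the equation for [X] follows from [U L = [S 0]] ([pair_P]).

    Subtraction-freeness is a matter of signs: [L] and its Schur complement [S] have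
    nonpositive off-diagonal entries, everything else is nonnegative, and the
    triplets come from [L 1 = w]. *)

Set Implicit Arguments.
Unset Strict Implicit.
Unset Printing Implicit Defensive.

Import Order.TTheory GRing.Theory Num.Theory.
Import numFieldNormedType.Exports.
Local Open Scope ring_scope.

(** * Nonnegative matrices and M-matrices *)

Section MxOrder.
Variable R : realFieldType.

Definition mx_le m n (M N : 'M[R]_(m, n)) : Prop := forall i j, M i j <= N i j.

Definition Zmx n (M : 'M[R]_n) : Prop := forall i j, i != j -> M i j <= 0.

Lemma mx_ge0_mul m n p (M : 'M[R]_(m, n)) (N : 'M[R]_(n, p)) :
  mx_ge0 M -> mx_ge0 N -> mx_ge0 (M *m N).
Proof. by move=> M0 N0 i j; rewrite mxE sumr_ge0 // => k _; rewrite mulr_ge0. Qed.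

Lemma mx_ge0_add m n (M N : 'M[R]_(m, n)) :
  mx_ge0 M -> mx_ge0 N -> mx_ge0 (M + N).
Proof. by move=> M0 N0 i j; rewrite mxE addr_ge0. Qed.

Lemma mx_leP m n (M N : 'M[R]_(m, n)) : mx_le M N <-> mx_ge0 (N - M).
Proof.
by split=> H i j; [rewrite !mxE subr_ge0 | have:= H i j; rewrite !mxE subr_ge0].
Qed.

Lemma mx_le_mull m n p (M : 'M[R]_(m, n)) (N N' : 'M[R]_(n, p)) :
  mx_ge0 M -> mx_le N N' -> mx_le (M *m N) (M *m N').
Proof. by move=> M0 /mx_leP N0; apply/mx_leP; rewrite -mulmxBr; exact: mx_ge0_mul. Qed.

Lemma mx_le_mulr m n p (M M' : 'M[R]_(m, n)) (N : 'M[R]_(n, p)) :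
  mx_ge0 N -> mx_le M M' -> mx_le (M *m N) (M' *m N).
Proof. by move=> N0 /mx_leP M0; apply/mx_leP; rewrite -mulmxBl; exact: mx_ge0_mul. Qed.

Lemma mx_le_trans m n (N M P : 'M[R]_(m, n)) : mx_le M N -> mx_le N P -> mx_le M P.
Proof. by move=> h1 h2 i j; exact: le_trans (h1 i j) (h2 i j). Qed.

Lemma mx_ge0_ones n : mx_ge0 (ones R n).
Proof. by move=> i j; rewrite mxE. Qed.

Lemma mulmx_onesE m n (M : 'M[R]_(m, n)) i j : (M *m ones R n) i j = \sum_k M i k.
Proof. by rewrite mxE; apply: eq_bigr => k _; rewrite mxE mulr1. Qed.

(** If row [i] of [W] had negative entries, then summing [(W *m M) i k * x k 0] over
    their columns would give a negative number: the terms with [W i l >= 0] only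
    meet off-diagonal entries of [M], and on the others truncating the row sums
    [M *m x] to these columns can only increase them. *)
Lemma Zmx_monotone m n (M : 'M[R]_n) (x : 'cV[R]_n) (W : 'M[R]_(m, n)) :
  Zmx M -> mx_gt0 x -> mx_gt0 (M *m x) -> mx_ge0 (W *m M) -> mx_ge0 W.
Proof.
move=> ZM x0 Mx0 WM i j; rewrite leNgt; apply/negP => Wij.
pose N := [pred k | W i k < 0].
have: 0 <= \sum_(k | N k) (W *m M) i k * x k 0.
  by rewrite sumr_ge0 // => k _; rewrite mulr_ge0 // ltW.
apply/negP; rewrite -ltNge.
have -> : \sum_(k | N k) (W *m M) i k * x k 0
        = \sum_l W i l * \sum_(k | N k) M l k * x k 0.
  under eq_bigr do rewrite mxE mulr_suml.
  rewrite exchange_big; apply: eq_bigr => l _; rewrite mulr_sumr.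
  by apply: eq_bigr => k _; rewrite mulrA.
have neg l : N l -> W i l * \sum_(k | N k) M l k * x k 0 < 0.
  move=> Nl; rewrite nmulr_rlt0 //; apply: lt_le_trans (Mx0 l 0) _.
  rewrite mxE (bigID N) /= gerDl sumr_le0 // => k Nk.
  rewrite mulr_le0_ge0 ?(ltW (x0 _ _)) // ZM //.
  by apply: contraNneq Nk => <-.
rewrite (bigD1 j) //= -[ltRHS]addr0 ltr_leD ?neg //.
apply: sumr_le0 => l _; case: (boolP (N l)) => [/neg/ltW //|Nl].
rewrite mulr_ge0_le0 //; first by rewrite leNgt.
apply: sumr_le0 => k Nk; rewrite mulr_le0_ge0 ?(ltW (x0 _ _)) // ZM //.
by apply: contraNneq Nl => ->.
Qed.

(** Semipositivity rather than a spectral radius: the positive vector [x] is what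
    the elimination and the Schur complements below carry along. *)
Definition nonsing_Mmx n (M : 'M[R]_n) : Prop :=
  Zmx M /\ exists2 x : 'cV[R]_n, mx_gt0 x & mx_gt0 (M *m x).

Lemma nonsing_Mmx_unit n (M : 'M[R]_n) : nonsing_Mmx M -> M \in unitmx.
Proof.
move=> [ZM [x x0 Mx0]]; rewrite -row_free_unit; apply: inj_row_free => v vM.
have v0 : mx_ge0 v by apply: (Zmx_monotone ZM x0 Mx0) => i j; rewrite vM mxE.
have Nv0 : mx_ge0 (- v).
  by apply: (Zmx_monotone ZM x0 Mx0) => i j; rewrite mulNmx vM !mxE oppr0.
apply/matrixP => i j; apply/eqP; rewrite mxE eq_le v0 andbT.
by have := Nv0 i j; rewrite mxE oppr_ge0.
Qed.

Lemma nonsing_Mmx_inv_ge0 n (M : 'M[R]_n) : nonsing_Mmx M -> mx_ge0 (invmx M).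
Proof.
move=> nM; have uM := nonsing_Mmx_unit nM; case: nM => ZM [x x0 Mx0].
by apply: (Zmx_monotone ZM x0 Mx0) => i j; rewrite mulVmx // mxE ler0n.
Qed.

(** Because [invmx M - invmx M' = invmx M *m (M' - M) *m invmx M']. *)
Lemma nonsing_Mmx_inv_le n (M M' : 'M[R]_n) :
  nonsing_Mmx M -> nonsing_Mmx M' -> mx_le M M' -> mx_le (invmx M') (invmx M).
Proof.
move=> nM nM' /mx_leP leM; apply/mx_leP.
have -> : invmx M - invmx M' = invmx M *m (M' - M) *m invmx M'.
  rewrite mulmxBr mulmxBl mulVmx ?nonsing_Mmx_unit // mul1mx.
  by rewrite -mulmxA mulmxV ?nonsing_Mmx_unit // mulmx1.
by do 2?[apply: mx_ge0_mul] => //; exact: nonsing_Mmx_inv_ge0.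
Qed.

(** The Schur complement inherits the positive vector: it maps the upper part of
    [x] to the upper part of [M *m x], plus a nonnegative multiple of the lower. *)
Lemma nonsing_Mmx_schur m n (M : 'M[R]_(m + n)) :
  nonsing_Mmx M ->
  [/\ nonsing_Mmx (drsubmx M), mx_ge0 (- (ursubmx M *m invmx (drsubmx M)))
    & nonsing_Mmx (ulsubmx M - ursubmx M *m invmx (drsubmx M) *m dlsubmx M)].
Proof.
move=> [ZM [x x0 Mx0]].
have ur_le0 i j : ursubmx M i j <= 0.
  by rewrite !mxE ZM // eq_lrshift.
have dl_le0 i j : dlsubmx M i j <= 0.
  by rewrite !mxE ZM // eq_rlshift.
have x1 : mx_gt0 (usubmx x) by move=> i j; rewrite mxE.
have x2 : mx_gt0 (dsubmx x) by move=> i j; rewrite mxE.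
have Mx1 : usubmx (M *m x) = ulsubmx M *m usubmx x + ursubmx M *m dsubmx x.
  by rewrite -{1}[M]submxK -{1}[x]vsubmxK mul_block_col col_mxKu.
have Mx2 : dsubmx (M *m x) = dlsubmx M *m usubmx x + drsubmx M *m dsubmx x.
  by rewrite -{1}[M]submxK -{1}[x]vsubmxK mul_block_col col_mxKd.
have n22 : nonsing_Mmx (drsubmx M).
  split=> [i j ij|]; first by rewrite !mxE ZM // eq_rshift.
  exists (dsubmx x) => // i j.
  have : 0 < dsubmx (M *m x) i j by rewrite mxE.
  rewrite Mx2 mxE => /lt_le_trans; apply; rewrite gerDr mxE sumr_le0 // => k _.
  by rewrite mulr_le0_ge0 // ltW.
have Psi0 : mx_ge0 (- (ursubmx M *m invmx (drsubmx M))).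
  rewrite -mulNmx; apply: mx_ge0_mul; last exact: nonsing_Mmx_inv_ge0.
  by move=> i j; rewrite mxE oppr_ge0.
split=> //; rewrite -mulNmx.
set Psi := - _ in Psi0 *; split=> [i j ij|].
  rewrite mxE [X in X + _]mxE [X in X + _]mxE -[leRHS]addr0 lerD ?ZM ?eq_lshift //.
  by rewrite mxE sumr_le0 // => k _; rewrite mulr_ge0_le0.
exists (usubmx x) => //.
have PsiM : Psi *m drsubmx M = - ursubmx M.
  by rewrite /Psi mulNmx -mulmxA mulVmx ?nonsing_Mmx_unit // mulmx1.
move: Psi Psi0 PsiM => Psi Psi0 PsiM.
have -> : (ulsubmx M + Psi *m dlsubmx M) *m usubmx x
        = usubmx (M *m x) + Psi *m dsubmx (M *m x).
  rewrite Mx1 Mx2 mulmxDl mulmxDr !mulmxA PsiM mulNmx.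
  by rewrite addrACA subrr addr0.
move=> i j; rewrite mxE ltr_pwDl //; first by rewrite mxE.
by rewrite mxE sumr_ge0 // => k _; rewrite mulr_ge0 // mxE ltW.
Qed.

End MxOrder.

Section Spectrum.
Variable R : realType.
Local Notation C := R[i].

Lemma cplx_mxM m n p (M : 'M[R]_(m, n)) (N : 'M[R]_(n, p)) :
  cplx_mx (M *m N) = cplx_mx M *m cplx_mx N.
Proof. exact: map_mxM. Qed.

(** With [|w| |z| <= |w| N] for a left eigenvector [w], weighting by [x] gives
    [|z| (|w| x) <= |w| N x <= s (|w| x)], and [|w| x > 0]. *)
Lemma spectral_bound n (N : 'M[R]_n) (x : 'cV[R]_n) (s : R) (z : C) :
  mx_ge0 N -> mx_gt0 x -> mx_le (N *m x) (s *: x) ->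
  eigenvalue (cplx_mx N) z -> `|z| <= (s%:C)%C.
Proof.
move=> N0 x0 Nx /eigenvalueP[w wN w0].
pose c (r : R) : C := (r%:C)%C.
pose t := \sum_j `|w 0 j| * c (x j 0).
have cx j : 0 < c (x j 0) by rewrite /c ltcR.
have t0 : 0 < t.
  have [j wj] : exists j, w 0 j != 0 by apply/rV0Pn.
  rewrite /t (bigD1 j) //= ltr_pwDl ?mulr_gt0 ?normr_gt0 //.
  by rewrite sumr_ge0 // => k _; rewrite mulr_ge0 // ltW.
rewrite -(ler_pM2r t0).
have -> : `|z| * t = \sum_j `|\sum_i w 0 i * c (N i j)| * c (x j 0).
  rewrite /t mulr_sumr; apply: eq_bigr => j _; rewrite mulrA -normrM.
  congr (`|_| * _); have /matrixP/(_ 0 j) := wN; rewrite !mxE => <-.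
  by apply: eq_bigr => i _; rewrite mxE.
apply: (@le_trans _ _ (\sum_j \sum_i `|w 0 i| * c (N i j) * c (x j 0))).
  apply: ler_sum => j _; rewrite -mulr_suml ler_wpM2r ?(ltW (cx _)) //.
  apply: le_trans (ler_norm_sum _ _ _) _; apply: ler_sum => i _.
  by rewrite normrM ler_wpM2l // ger0_norm // /c lecR.
rewrite exchange_big /= /t mulr_sumr; apply: ler_sum => i _.
rewrite mulrCA.
under eq_bigr do rewrite -mulrA; rewrite -mulr_sumr ler_wpM2l //.
rewrite /c -rmorphM /=; under eq_bigr do rewrite -rmorphM /=.
by rewrite -rmorph_sum lecR; have := Nx i 0; rewrite !mxE.
Qed.

Lemma nonsing_Mmx_Mmatrix n (M : 'M[R]_n) : nonsing_Mmx M -> Mmatrix M.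
Proof.
move=> [ZM [x x0 Mx0]]; pose s := \sum_i `|M i i|.
have N0 : mx_ge0 (s%:M - M).
  move=> i j; rewrite !mxE; case: eqVneq => [->|ij]; last first.
    by rewrite sub0r oppr_ge0 ZM.
  rewrite subr_ge0 /s (bigD1 j) //= -[leLHS]addr0 lerD ?ler_norm //.
  by rewrite sumr_ge0.
exists s, (s%:M - M); split=> //; first by rewrite opprB addrC subrK.
move=> z; apply: (spectral_bound N0 x0) => i j.
rewrite mulmxBl mul_scalar_mx mxE [X in _ + X]mxE gerDl oppr_le0 ltW //.
Qed.

(** Strict diagonal dominance with weights: for a left kernel vector [w] the sum
    of [|w j| |M j j| x j] would be smaller than itself. *)
Lemma dominant_unit (F : numFieldType) n (M : 'M[F]_n) (x : 'I_n -> F) :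
  (forall i, 0 < x i) ->
  (forall i, \sum_(j | j != i) `|M i j| * x j < `|M i i| * x i) ->
  M \in unitmx.
Proof.
move=> x0 dom; rewrite -row_free_unit; apply: inj_row_free => w wM.
apply/eqP/negPn/negP => /rV0Pn[i0 wi0].
suff: \sum_i `|w 0 i| * (`|M i i| * x i) < \sum_i `|w 0 i| * (`|M i i| * x i).
  by rewrite ltxx.
apply: (@le_lt_trans _ _ (\sum_i `|w 0 i| * \sum_(j | j != i) `|M i j| * x j)).
  under [leRHS]eq_bigr do rewrite mulr_sumr.
  rewrite (exchange_big_dep xpredT) //=; apply: ler_sum => j _.
  rewrite mulrA -normrM; have /matrixP/(_ 0 j) := wM; rewrite !mxE.
  rewrite (bigD1 j) //= => /eqP; rewrite addr_eq0 => /eqP ->; rewrite normrN.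
  under [leRHS]eq_bigr do rewrite mulrA -normrM.
  under [leRHS]eq_bigl do rewrite eq_sym.
  by rewrite -mulr_suml ler_wpM2r ?(ltW (x0 _)) // ler_norm_sum.
rewrite [ltLHS](bigD1 i0) //= [ltRHS](bigD1 i0) //= ltr_leD //.
  by rewrite ltr_pM2l ?normr_gt0.
by apply: ler_sum => i _; rewrite ler_wpM2l // ltW.
Qed.

End Spectrum.

(** * Cyclic reduction as a subsequence of level-by-level elimination *)

(** The Sherman-Morrison-Woodbury identity; the invertibility of the left-hand
    side is part of the conclusion. *)
Lemma schur_complement_inv (F : fieldType) n (A B C S : 'M[F]_n) :
  S \in unitmx -> B \in unitmx -> B - C *m invmx S *m A \in unitmx ->
  S - A *m invmx B *m C \in unitmx /\
  invmx (S - A *m invmx B *m C)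
  = invmx S + invmx S *m A *m invmx (B - C *m invmx S *m A) *m C *m invmx S.
Proof.
move=> uS uB; set T := B - _ => uT; set M := S - _; set N := _ + _.
have MN : M *m N = 1%:M.
  rewrite /M /N mulmxBl !mulmxDr mulmxV // !mulmxA mulmxV // mul1mx.
  have -> : A *m invmx B *m C *m invmx S *m A = A *m invmx B *m (B - T).
    by rewrite /T opprB addrC subrK !mulmxA.
  rewrite mulmxBr -(mulmxA A (invmx B) B) mulVmx // mulmx1 !mulmxBl.
  rewrite -(mulmxA (A *m invmx B) T) mulmxV // mulmx1.
  by rewrite subrKC addrK.
have [uM _] := mulmx1_unit MN; split=> //.
by rewrite -[N]mul1mx -(mulVmx uM) -mulmxA MN mulmx1.
Qed.

Section Doubling.
Variables (R : realType) (n : nat).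
Implicit Types A B C : 'M[R]_n.

(** The Schur complement, onto the last level, of the block tridiagonal matrix
    with [m + 1] levels and blocks [B], [- C] and [- A]. *)
Definition level_schur A B C (m : nat) : 'M[R]_n :=
  iter m (fun S => B - C *m invmx S *m A) B.

Lemma level_schurS A B C m :
  level_schur A B C m.+1 = B - C *m invmx (level_schur A B C m) *m A.
Proof. by []. Qed.

Lemma level_schur_sub_unit A B C m :
  (forall j, level_schur A B C j \in unitmx) ->
  level_schur A B C m - A *m invmx B *m C \in unitmx.
Proof.
move=> uS.
by have [] := @schur_complement_inv _ _ A B C _ (uS m) (uS 0%N) (uS m.+1).
Qed.

(** A step of cyclic reduction eliminates every other level, and the remaining
    ones are then eliminated one after the other.  In the reduced system the last
    level has also had its neighbour on the far side eliminated, which accounts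
    for the term [A *m invmx B *m C]. *)
Lemma level_schur_double A B C m :
  (forall j, level_schur A B C j \in unitmx) ->
  level_schur (A *m invmx B *m A)
    (B - A *m invmx B *m C - C *m invmx B *m A) (C *m invmx B *m C) m
  = level_schur A B C m.*2.+1 - A *m invmx B *m C.
Proof.
move=> uS; elim: m => [|m IHm]; first by rewrite /= addrAC.
rewrite level_schurS IHm doubleS [in RHS]level_schurS.
have uT := level_schur_sub_unit m.*2.+1 uS.
rewrite [level_schur A B C m.*2.+2]level_schurS.
have [_ ->] := @schur_complement_inv _ _ C _ A B (uS 0%N) (uS m.*2.+1) uT.
rewrite mulmxDr mulmxDl !mulmxA opprD !addrA.
by rewrite [in LHS](addrAC B) [LHS]addrAC.
Qed.

Section Iterates.
Variables A B C : 'M[R]_n.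
Hypothesis uS : forall m, level_schur A B C m \in unitmx.

Let A_ k := cr_A (cyclic_reduction A B C k).
Let B_ k := cr_B (cyclic_reduction A B C k).
Let C_ k := cr_C (cyclic_reduction A B C k).
Let Bh_ k := cr_Bhat (cyclic_reduction A B C k).

Lemma cyclic_reductionS k :
  [/\ A_ k.+1 = A_ k *m invmx (B_ k) *m A_ k,
      B_ k.+1 = B_ k - A_ k *m invmx (B_ k) *m C_ k
                     - C_ k *m invmx (B_ k) *m A_ k,
      C_ k.+1 = C_ k *m invmx (B_ k) *m C_ k
    & Bh_ k.+1 = Bh_ k - C_ k *m invmx (B_ k) *m A_ k].
Proof.
by rewrite /A_ /B_ /C_ /Bh_ /cyclic_reduction iterS; case: (iter k _ _).
Qed.

(** After [k] steps one level of the reduced system stands for [2 ^ k] original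
    ones; the last of them differs from the others by [Bh_ k - B_ k], as nothing
    was eliminated beyond it. *)
Lemma cyclic_reduction_schur k m :
  level_schur (A_ k) (B_ k) (C_ k) m \in unitmx /\
  level_schur (A_ k) (B_ k) (C_ k) m + (Bh_ k - B_ k)
  = level_schur A B C (m.+1 * 2 ^ k).-1.
Proof.
elim: k m => [|k IHk] m; first by rewrite muln1 subrr addr0; split; first exact: uS.
have uSk j := (IHk j).1.
have [-> eB -> eBh] := cyclic_reductionS k.
rewrite eB level_schur_double //; split; first exact: level_schur_sub_unit.
have -> : (m.+1 * 2 ^ k.+1).-1 = (m.*2.+2 * 2 ^ k).-1 by rewrite expnS; lia.
rewrite -(IHk m.*2.+1).2 eBh -addrA; congr (_ + _).
by rewrite opprB [_ + (_ - (_ - _))]addrA subrK opprB addrCA addKr.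
Qed.

Lemma cyclic_reduction_unit k : B_ k \in unitmx.
Proof. exact: (cyclic_reduction_schur k 0).1. Qed.

Lemma cyclic_reduction_Bhat k : Bh_ k = level_schur A B C (2 ^ k).-1.
Proof. by rewrite -[(2 ^ k)%N]mul1n -(cyclic_reduction_schur k 0).2 /= subrKC. Qed.

(** The second identity shows that the limit of [C_k 1] comes for free with that
    of [Bh_k], and that it completes the triplet of the limit. *)
Lemma cyclic_reduction_row_sums k :
  B *m ones R n = (A + C) *m ones R n ->
  B_ k *m ones R n = (A_ k + C_ k) *m ones R n /\
  Bh_ k *m ones R n = (A + C_ k) *m ones R n.
Proof.
move=> B1; elim: k => [//|k [IHB IHBh]].
set e := ones R n in IHB IHBh *.
have uB := cyclic_reduction_unit k.
have [-> -> -> ->] := cyclic_reductionS k.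
have eC : invmx (B_ k) *m (C_ k *m e) = e - invmx (B_ k) *m (A_ k *m e).
  apply/eqP; rewrite -subr_eq opprK -mulmxDr addrC -mulmxDl -IHB.
  by rewrite mulmxA mulVmx // mul1mx.
have eA : invmx (B_ k) *m (A_ k *m e) = e - invmx (B_ k) *m (C_ k *m e).
  by rewrite eC opprB addrC subrK.
split.
  rewrite !mulmxBl IHB !mulmxDl -!mulmxA [in X in _ - X - _]eC [in X in _ - _ - X]eA.
  rewrite !mulmxBr -addrA -opprD.
  rewrite [_ - _ + (_ - _)]addrACA -opprD opprB addrC subrK //.
rewrite mulmxBl IHBh !mulmxDl -!mulmxA eA mulmxBr opprB.
by rewrite addrACA subrr addr0.
Qed.

End Iterates.
End Doubling.

(** * Entrywise limits *)

Section MxCvg.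
Variable R : realType.

Definition mx_cvg m n (M : nat -> 'M[R]_(m, n)) (L : 'M[R]_(m, n)) : Prop :=
  forall i j, ((fun k => M k i j) @ \oo --> L i j)%classic.

Lemma mx_cvg_lim m n (M : nat -> 'M[R]_(m, n)) L : mx_cvg M L -> mx_lim M = L.
Proof.
by move=> ML; apply/matrixP => i j; rewrite mxE; apply: cvg_lim => //; exact: ML.
Qed.

Lemma mx_cvg_unique m n (M : nat -> 'M[R]_(m, n)) L L' :
  mx_cvg M L -> mx_cvg M L' -> L = L'.
Proof. by move=> /mx_cvg_lim <- /mx_cvg_lim <-. Qed.

Lemma mx_cvg_cst m n (M : 'M[R]_(m, n)) : mx_cvg (fun=> M) M.
Proof. by move=> i j; exact: cvg_cst. Qed.

Lemma mx_cvgB m n (M N : nat -> 'M[R]_(m, n)) L K :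
  mx_cvg M L -> mx_cvg N K -> mx_cvg (fun k => M k - N k) (L - K).
Proof.
move=> ML NK i j; rewrite !mxE; under eq_fun do rewrite !mxE.
by apply: cvgB; [exact: ML | exact: NK].
Qed.

Lemma mx_cvgM m n p (M : nat -> 'M[R]_(m, n)) (N : nat -> 'M[R]_(n, p)) L K :
  mx_cvg M L -> mx_cvg N K -> mx_cvg (fun k => M k *m N k) (L *m K).
Proof.
move=> ML NK i j; rewrite !mxE; under eq_fun do rewrite !mxE.
by apply: cvg_big => [|l _]; [exact: add_continuous | apply: cvgM];
  [exact: ML | exact: NK].
Qed.

Lemma mx_cvgS m n (M : nat -> 'M[R]_(m, n)) L :
  mx_cvg M L -> mx_cvg (fun k => M k.+1) L.
Proof.
by move=> ML i j; have := ML i j; rewrite -(cvg_shiftS (fun k => M k i j)).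
Qed.

Lemma mx_cvg_subseq m n (M : nat -> 'M[R]_(m, n)) L (phi : nat -> nat) :
  (forall k, (k <= phi k)%N) -> mx_cvg M L -> mx_cvg (M \o phi) L.
Proof.
move=> le_phi ML i j; apply: (cvg_comp phi (fun k => M k i j)) (ML i j).
by move=> A [N _ NA]; exists N => // k /= /leq_trans Nk; apply/NA/Nk.
Qed.

Lemma mx_cvg_le m n (M N : nat -> 'M[R]_(m, n)) L K :
  mx_cvg M L -> mx_cvg N K -> (forall k, mx_le (M k) (N k)) -> mx_le L K.
Proof.
move=> ML NK le_MN i j; apply: ler_cvg_to (ML i j) (NK i j) _.
by apply: nearW => k; exact: le_MN.
Qed.

Lemma mx_noninc_cvg m n (M : nat -> 'M[R]_(m, n)) (K : 'M[R]_(m, n)) :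
  (forall k, mx_le (M k.+1) (M k)) -> (forall k, mx_le K (M k)) ->
  exists2 L, mx_cvg M L & forall k, mx_le L (M k).
Proof.
move=> dM lbM.
have homo i j : {homo (fun k => M k i j) : k l / (k <= l)%N >-> l <= k}.
  by apply/nonincreasing_seqP => k; exact: dM.
have cM i j : cvgn (fun k => M k i j).
  apply: nonincreasing_is_cvgn => //.
  by exists (K i j) => _ [k _ <-]; exact: lbM.
exists (mx_lim M) => [i j | k i j]; rewrite mxE; first exact: cM.
exact: nonincreasing_cvgn_ge.
Qed.

Lemma mx_nondec_cvg m n (M : nat -> 'M[R]_(m, n)) (K : 'M[R]_(m, n)) :
  (forall k, mx_le (M k) (M k.+1)) -> (forall k, mx_le (M k) K) ->
  exists L, mx_cvg M L.
Proof.
move=> dM ubM.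
have [k i j|k i j|L NL _] := @mx_noninc_cvg _ _ (fun k => 0 - M k) (- K).
- by rewrite !mxE !add0r lerN2; exact: dM.
- by rewrite !mxE add0r lerN2; exact: ubM.
exists (0 - L); have := mx_cvgB (@mx_cvg_cst _ _ 0) NL.
by under eq_fun do rewrite subKr.
Qed.

End MxCvg.

(** * The limit of the elimination *)

Section LevelProcess.
Variables (R : realType) (n : nat).
Implicit Types S : 'M[R]_n.

(** The columns in [E] stand in for irreducibility in the proof that every pivot is
    nonsingular: a phase of [E] may have a zero row sum, but its column is that of
    a positive diagonal matrix and remains so throughout the elimination. *)
Record level_blocks (A B C : 'M[R]_n) (E : pred 'I_n) : Prop := LevelBlocks {
  lb_A_ge0 : mx_ge0 A;
  lb_A_diag : forall i j, i != j -> A i j = 0;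
  lb_A_gt0 : forall i, ~~ E i -> 0 < A i i;
  lb_A_eq0 : forall i, E i -> A i i = 0;
  lb_B_Zmx : Zmx B;
  lb_B_diag : forall i j, E j -> i != j -> B i j = 0;
  lb_B_gt0 : forall i, E i -> 0 < B i i;
  lb_C_ge0 : mx_ge0 C;
  lb_row_sums : B *m ones R n = (A + C) *m ones R n }.

Variables (A B C : 'M[R]_n) (E : pred 'I_n).
Hypothesis lbABC : level_blocks A B C E.

(** What every pivot of the elimination shares with [B]: these properties are
    preserved by [fun S => B - C *m invmx S *m A] and by limits, and they make [S]
    a nonsingular M-matrix. *)
Record level_matrix S : Prop := LevelMatrix {
  lm_Zmx : Zmx S;
  lm_row_sums : mx_le (A *m ones R n) (S *m ones R n);
  lm_col : forall i j, E j -> S i j = B i j }.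

(** The row sums of a pivot [S] may vanish on [E], where [A] does; there the only
    nonzero entry of the column is the positive diagonal one, so doubling the
    weight of [E] makes the weighted row sums positive. *)
Definition level_weight : 'cV[R]_n := \col_i (if E i then 2 else 1).

Lemma level_weight_gt0 : mx_gt0 level_weight.
Proof. by move=> i j; rewrite mxE; case: (E i). Qed.

Lemma level_matrix_weight S i : level_matrix S ->
  (A *m ones R n) i 0 + (if E i then B i i else 0) <= (S *m level_weight) i 0.
Proof.
move=> lS; have -> : level_weight = ones R n + \col_i (E i)%:R.
  by apply/matrixP => k l; rewrite !mxE; case: (E k); rewrite ?addr0.
rewrite mulmxDr [leRHS]mxE lerD ?(lm_row_sums lS) // [leRHS]mxE (bigD1 i) //= big1.
  by rewrite !mxE addr0; case: ifP => [Ei|]; rewrite ?mulr0 // (lm_col lS) ?mulr1.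
move=> k ki; rewrite mxE; case: (boolP (E k)) => Ek; last by rewrite mulr0.
by rewrite (lm_col lS) // (lb_B_diag lbABC Ek) ?mul0r // eq_sym.
Qed.

Lemma level_A_ones i : (A *m ones R n) i 0 = A i i.
Proof.
rewrite mulmx_onesE (bigD1 i) //= big1 ?addr0 // => k ki.
by rewrite (lb_A_diag lbABC) // eq_sym.
Qed.

Lemma level_matrix_nonsing S : level_matrix S -> nonsing_Mmx S.
Proof.
move=> lS; split; first exact: lm_Zmx lS.
exists level_weight => [|i j]; first exact: level_weight_gt0.
rewrite ord1; apply: lt_le_trans (level_matrix_weight i lS).
rewrite level_A_ones; case: (boolP (E i)) => Ei; last first.
  by rewrite addr0 (lb_A_gt0 lbABC).
by rewrite (lb_A_eq0 lbABC) // add0r (lb_B_gt0 lbABC).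
Qed.

Lemma level_matrix_B : level_matrix B.
Proof.
split=> //; first exact: lb_B_Zmx lbABC.
rewrite (lb_row_sums lbABC) mulmxDl; apply/mx_leP.
by rewrite addrAC subrr add0r; apply: mx_ge0_mul (lb_C_ge0 lbABC) (@mx_ge0_ones _ _).
Qed.

Lemma level_matrix_step S :
  level_matrix S -> level_matrix (B - C *m invmx S *m A).
Proof.
move=> lS; have nS := level_matrix_nonsing lS.
have iS0 := nonsing_Mmx_inv_ge0 nS; have [ZB A0 C0] :=
  And3 (lb_B_Zmx lbABC) (lb_A_ge0 lbABC) (lb_C_ge0 lbABC).
have CSA0 : mx_ge0 (C *m invmx S *m A) by do 2?[apply: mx_ge0_mul].
split=> [i j ij||i j Ej].
- by rewrite !mxE -[leRHS]subr0 lerB ?ZB //; have := CSA0 i j; rewrite mxE.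
- rewrite mulmxBl (lb_row_sums lbABC) mulmxDl -addrA; apply/mx_leP.
  rewrite addrAC subrr add0r; apply/mx_leP.
  rewrite -!mulmxA; apply: mx_le_mull => //.
  rewrite -[X in mx_le _ X](mulKmx (nonsing_Mmx_unit nS)).
  by apply: mx_le_mull (lm_row_sums lS).
- rewrite mxE [X in _ + X]mxE [X in _ - X]mxE big1 ?subr0 // => k _.
  have [->|kj] := eqVneq k j; first by rewrite (lb_A_eq0 lbABC) // mulr0.
  by rewrite (lb_A_diag lbABC kj) mulr0.
Qed.

Lemma level_schur_level m : level_matrix (level_schur A B C m).
Proof.
by elim: m => [|m IHm]; [exact: level_matrix_B | exact: level_matrix_step].
Qed.

Lemma level_schur_unit m : level_schur A B C m \in unitmx.
Proof. exact/nonsing_Mmx_unit/level_matrix_nonsing/level_schur_level. Qed.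

Lemma level_schur_noninc m :
  mx_le (level_schur A B C m.+1) (level_schur A B C m).
Proof.
have [A0 C0] := conj (lb_A_ge0 lbABC) (lb_C_ge0 lbABC).
have nS k := level_matrix_nonsing (level_schur_level k).
elim: m => [|m IHm].
  apply/mx_leP; rewrite opprB addrC subrK.
  by do 2?[apply: mx_ge0_mul] => //; exact: nonsing_Mmx_inv_ge0 (nS 0%N).
rewrite level_schurS [level_schur _ _ _ m.+1]level_schurS; apply/mx_leP.
rewrite opprB addrC addrA subrK; apply/mx_leP.
apply: mx_le_mulr => //; apply: mx_le_mull => //.
exact: nonsing_Mmx_inv_le (nS m.+1) (nS m) IHm.
Qed.

(** Row sums stay nonnegative, so that an entry cannot fall below the opposite of
    the sum of the other entries of its row, which only decrease. *)
Lemma level_schur_lbound m :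
  mx_le (B - B *m const_mx 1) (level_schur A B C m).
Proof.
have le_B k : mx_le (level_schur A B C k) B.
  elim: k => [|k IHk]; first by move=> i j.
  exact: mx_le_trans (level_schur_noninc k) IHk.
move=> i j; have lS := level_schur_level m.
have : 0 <= (level_schur A B C m *m ones R n) i 0.
  apply: le_trans (lm_row_sums lS i 0).
  exact: mx_ge0_mul (lb_A_ge0 lbABC) (@mx_ge0_ones _ _) i 0.
rewrite mulmx_onesE (bigD1 j) //= -lerBlDr sub0r; apply: le_trans.
rewrite !mxE (bigD1 j) //= !mxE mulr1 opprD addrA subrr add0r lerN2.
by apply: ler_sum => k _; rewrite mxE mulr1 le_B.
Qed.

(** The inverses of the iterates increase and are bounded by the inverse of the
    limit, so they converge too, and the recursion passes to the limit. *)
Lemma level_schur_cvg : exists2 L,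
  level_matrix L /\ L = B - C *m invmx L *m A & mx_cvg (level_schur A B C) L.
Proof.
have [L cL leL] := mx_noninc_cvg level_schur_noninc level_schur_lbound.
have nS k := level_matrix_nonsing (level_schur_level k).
have lL : level_matrix L.
  split=> [i j ij||i j Ej].
  - apply: cvgr_to_le (cL i j) _; apply: nearW => k.
    exact: lm_Zmx (level_schur_level k) _ _ ij.
  - apply: mx_cvg_le (@mx_cvg_cst _ _ _ _) (mx_cvgM cL (@mx_cvg_cst _ _ _ _)) _ => k.
    exact: lm_row_sums (level_schur_level k).
  - apply/le_anti/andP; split.
      apply: cvgr_to_le (cL i j) _; apply: nearW => k.
      by rewrite (lm_col (level_schur_level k) i Ej).
    apply: cvgr_to_ge (cL i j) _; apply: nearW => k.
    by rewrite (lm_col (level_schur_level k) i Ej).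
exists L => //; split=> //.
have nL := level_matrix_nonsing lL.
have [||K cK] := @mx_nondec_cvg _ _ _ (fun k => invmx (level_schur A B C k)) (invmx L).
- by move=> k; exact: nonsing_Mmx_inv_le (nS k.+1) (nS k) (level_schur_noninc k).
- by move=> k; exact: nonsing_Mmx_inv_le nL (nS k) (leL k).
have LK : L *m K = 1%:M.
  apply: mx_cvg_unique (mx_cvgM cL cK) _.
  by under eq_fun do rewrite mulmxV ?level_schur_unit //; exact: mx_cvg_cst.
have <- : K = invmx L.
  by rewrite -[RHS]mulmx1 -LK mulKmx // nonsing_Mmx_unit.
apply: mx_cvg_unique (mx_cvgS cL) _.
by apply: mx_cvgB (@mx_cvg_cst _ _ _ _) _; do 2?[apply: mx_cvgM] => //; exact: mx_cvg_cst.
Qed.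

Lemma cyclic_reduction_cvg L : mx_cvg (level_schur A B C) L ->
  mx_cvg (fun k => cr_Bhat (cyclic_reduction A B C k)) L.
Proof.
move=> cL; have eBh k : cr_Bhat (cyclic_reduction A B C k)
                        = level_schur A B C (2 ^ k).-1.
  exact: cyclic_reduction_Bhat level_schur_unit k.
under eq_fun do rewrite eBh.
by apply: (@mx_cvg_subseq _ _ _ _ _ (fun k => (2 ^ k).-1)) cL => k;
  have := ltn_expl k (erefl (1 < 2)%N); lia.
Qed.

Lemma level_schur_cvg_Bhat : mx_cvg (level_schur A B C) (Bhat_inf A B C).
Proof.
have [L _ cL] := level_schur_cvg; suff -> : Bhat_inf A B C = L by [].
exact/mx_cvg_lim/cyclic_reduction_cvg.
Qed.

Lemma level_limit (L := Bhat_inf A B C) :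
  level_matrix L /\ L = B - C *m invmx L *m A.
Proof.
have [L' [lL' eL'] cL'] := level_schur_cvg.
by rewrite /L (mx_cvg_unique level_schur_cvg_Bhat cL').
Qed.

Lemma level_limit_row_sums : Bhat_inf A B C *m ones R n = Bhat_inf_w A B C.
Proof.
rewrite /Bhat_inf_w -[LHS](subrKC (A *m ones R n)); congr (_ + _).
apply/esym/mx_cvg_lim.
have -> : (fun k => cr_C (cyclic_reduction A B C k) *m ones R n)
        = (fun k => cr_Bhat (cyclic_reduction A B C k) *m ones R n - A *m ones R n).
  apply: eq_fun => k.
  have [_ ->] := cyclic_reduction_row_sums level_schur_unit k (lb_row_sums lbABC).
  by rewrite mulmxDl addrAC subrr add0r.
apply: mx_cvgB _ (@mx_cvg_cst _ _ _ _); apply: mx_cvgM _ (@mx_cvg_cst _ _ _ _).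
exact: cyclic_reduction_cvg level_schur_cvg_Bhat.
Qed.

(** By induction, [u *m C *m invmx S <= u], so the step subtracts at most
    [u *m A] from [u *m B = u *m (A + C)]. *)
Lemma level_limit_stationary (u : 'rV[R]_n) :
  mx_gt0 u -> u *m B = u *m (A + C) -> mx_le (u *m C) (u *m Bhat_inf A B C).
Proof.
move=> u0 uB; have A0 := lb_A_ge0 lbABC.
apply: mx_cvg_le (@mx_cvg_cst _ _ _ _)
  (mx_cvgM (@mx_cvg_cst _ _ _ u) level_schur_cvg_Bhat) _ => m.
elim: m => [|m IHm].
  rewrite uB mulmxDr; apply/mx_leP; rewrite addrK.
  by apply: mx_ge0_mul => // i j; exact/ltW/u0.
have nS := level_matrix_nonsing (level_schur_level m).
rewrite level_schurS mulmxBr uB mulmxDr addrAC; apply/mx_leP.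
rewrite addrK; apply/mx_leP; rewrite !mulmxA.
apply: mx_le_mulr => //; rewrite -[X in mx_le _ X](mulmxK (nonsing_Mmx_unit nS)).
exact: mx_le_mulr (nonsing_Mmx_inv_ge0 nS) IHm.
Qed.

End LevelProcess.

(** * Characteristic polynomials *)

Lemma char_poly_sim (F : fieldType) n (P M N : 'M[F]_n) :
  P \in unitmx -> N *m P = P *m M -> char_poly M = char_poly N.
Proof.
move=> uP NP; have uPX : \det (map_mx polyC P) != 0.
  by rewrite det_map_mx polyC_eq0 -unitfE -unitmxE.
apply: (mulfI uPX); rewrite -det_mulmx [RHS]mulrC -det_mulmx; congr (\det _).
by rewrite mulmxBr mulmxBl -!map_mxM /= NP -scalar_mxC.
Qed.

Lemma char_poly_lblock (F : comNzRingType) m n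
    (M1 : 'M[F]_m) (M2 : 'M[F]_(n, m)) (M3 : 'M[F]_n) :
  char_poly (block_mx M1 0 M2 M3) = char_poly M1 * char_poly M3.
Proof.
rewrite /char_poly /char_poly_mx map_block_mx map_mx0 (scalar_mx_block m n 'X).
by rewrite opp_block_mx add_block_mx oppr0 addr0 det_lblock.
Qed.

Lemma char_poly_tr (F : comNzRingType) n (M : 'M[F]_n) :
  char_poly M^T = char_poly M.
Proof.
rewrite /char_poly -[RHS]det_tr /char_poly_mx linearB /= tr_scalar_mx.
by rewrite map_trmx.
Qed.

(** * Stationary vectors *)

Section Stationary.
Variables (F : realFieldType) (n : nat).
Implicit Types u w : 'rV[F]_n.

Lemma row_min_ratio u w (i0 : 'I_n) : mx_gt0 u ->
  exists t i, w 0 i = t * u 0 i /\ forall j, t * u 0 j <= w 0 j.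
Proof.
move=> u0; have [i _ min_i] := arg_minP (fun j => w 0 j / u 0 j) (erefl (xpredT i0)).
exists (w 0 i / u 0 i), i; split=> [|j]; first by rewrite divfK // gt_eqF.
by rewrite -ler_pdivlMr //; exact: min_i.
Qed.

(** Subtracting from [w] the largest possible multiple of [u] leaves a nonnegative
    kernel vector with a zero entry; zeros propagate backwards along the edges. *)
Lemma irreducible_left_kernel (Q : 'M[F]_n) u w :
  (forall i j, i != j -> 0 <= Q i j) -> mx_irreducible Q ->
  mx_gt0 u -> u *m Q = 0 -> w *m Q = 0 -> exists t, w = t *: u.
Proof.
move=> Q0 Qirr u0 uQ wQ.
case: (pickP 'I_n) => [i0 _|n0]; last first.
  by exists 0; apply/rowP => i; have := n0 i.
have [t [i [wi le_tu]]] := row_min_ratio w i0 u0.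
exists t; apply/eqP; rewrite -subr_eq0; apply/eqP; set v := w - _.
have v0 j : 0 <= v 0 j by rewrite !mxE subr_ge0.
have vQ : v *m Q = 0 by rewrite mulmxBl -scalemxAl uQ wQ scaler0 subr0.
have vi : v 0 i = 0 by rewrite !mxE wi subrr.
clearbody v; have back k j : v 0 j = 0 -> mx_rel Q k j -> v 0 k = 0.
  move=> vj Qkj; have /matrixP/(_ 0 j) := vQ; rewrite !mxE => /eqP.
  rewrite psumr_eq0 => [/allP/(_ k (mem_index_enum k))/=|l _].
    by rewrite mulf_eq0 (negPf (Qkj : Q k j != 0)) orbF => /eqP.
  by have [->|lj] := eqVneq l j; rewrite ?vj ?mul0r // mulr_ge0 ?Q0.
apply/rowP => k; rewrite [RHS]mxE.
have /connectP[p] := Qirr k i.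
elim: p k => [|l p IHp] k /=; first by move=> _ <-.
by move=> /andP[Qkl pl] il; apply: back Qkl; exact: IHp.
Qed.

(** A second independent generalised eigenvector would be a [w] with
    [w *m M = w + u]; if [w + s *: u <= 0] with equality somewhere, then
    applying [M] gives [w + u + s *: u <= 0], a contradiction there. *)
Lemma stationary_no_jordan (M : 'M[F]_n) u w (i0 : 'I_n) :
  mx_ge0 M -> mx_gt0 u -> u *m M = u -> w *m M <> w + u.
Proof.
move=> M0 u0 uM wM; have [t [i [wi le_tu]]] := row_min_ratio (- w) i0 u0.
have : mx_le ((t *: u) *m M) (- w *m M).
  by apply: mx_le_mulr => // k j; rewrite ord1 mxE le_tu.
move=> /(_ 0 i); rewrite -scalemxAl uM mulNmx wM.
move: wi; rewrite !mxE => wi; rewrite opprD wi lerDl oppr_ge0.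
by rewrite leNgt u0.
Qed.

End Stationary.

(** The change of basis that makes [u] the first basis vector turns [M] into
    a block triangular matrix with blocks [1] and [M']; a fixed row vector of
    [M'] lifts to a row vector fixed by [M] up to a multiple of [u]. *)
Lemma stationary_deflation (F : fieldType) m (M : 'M[F]_(1 + m)) (u : 'rV_(1 + m)) :
  u 0 0 != 0 -> u *m M = u ->
  exists2 p : {poly F}, char_poly M = ('X - 1) * p &
    root p 1 -> exists2 w : 'rV_(1 + m), (forall t, w <> t *: u) &
      exists c, w *m M = w + c *: u.
Proof.
move=> u00 uM.
pose P : 'M[F]_(1 + m) := col_mx u (row_mx 0 1%:M).
have uP : P \in unitmx.
  rewrite /P -[u]hsubmxK -/(block_mx _ _ _ _) unitmxE det_ublock det1 mulr1.
  by rewrite det_mx11 mxE unitfE (_ : lshift m 0 = 0) //; apply: val_inj.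
pose e : 'rV[F]_(1 + m) := row_mx 1%:M 0.
have eP : e *m P = u by rewrite mul_row_col mul1mx mul0mx addr0.
pose N := P *m M *m invmx P.
have eN : e *m N = e by rewrite !mulmxA eP uM -eP mulmxK.
have NP : N *m P = P *m M by rewrite mulmxKV.
have Nblk : N = block_mx 1%:M 0 (dlsubmx N) (drsubmx N).
  rewrite -{1}[N]submxK; have := eN; rewrite -{1}[N]submxK mul_row_block.
  by rewrite !mul1mx !mul0mx !addr0 => /eq_row_mx[-> ->].
exists (char_poly (drsubmx N)).
  rewrite (char_poly_sim uP NP) Nblk char_poly_lblock block_mxKdr.
  congr (_ * _); rewrite /char_poly det_mx11 !mxE eqxx !mulr1n.
  by rewrite polyC1.
rewrite -eigenvalue_root_char => /eigenvalueP[w' w'N w'0].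
pose v : 'rV[F]_(1 + m) := row_mx 0 w'.
exists (v *m P) => [t wt|].
  have /(canLR (mulmxK uP)) : v *m P = (t *: e) *m P by rewrite -scalemxAl eP.
  rewrite mulmxK // /v scale_row_mx scaler0 => /eq_row_mx[_ w'E].
  by rewrite w'E eqxx in w'0.
exists ((w' *m dlsubmx N) 0 0).
rewrite -mulmxA -NP mulmxA Nblk mul_row_block !mul0mx !add0r w'N scale1r.
rewrite -eP (scalemxAl _ e P) -mulmxDl; congr (_ *m _).
rewrite scale_row_mx scaler0 add_row_mx addr0 add0r; congr row_mx.
rewrite block_mxKdl [LHS]mx11_scalar scale_scalar_mx mulr1 //.
Qed.


(** By deflation, a multiple eigenvalue [1] would produce a second independent
    fixed vector or a Jordan chain ending at [u]. *)
Lemma stationary_simple (F : realFieldType) n (M : 'M[F]_n) (u : 'rV[F]_n)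
    (i0 : 'I_n) :
  mx_ge0 M -> mx_gt0 u -> u *m M = u ->
  (forall w : 'rV[F]_n, w *m M = w -> exists t, w = t *: u) ->
  exists2 p : {poly F}, char_poly M = ('X - 1) * p & ~~ root p 1.
Proof.
case: n M u i0 => [|m] M u i0 M0 u0 uM fixM; first by case: i0.
have [p cM pP] := @stationary_deflation F m M u (lt0r_neq0 (u0 0 0)) uM.
exists p => //; apply/negP => /pP[w w_u [c wM]].
have [c0|c0] := eqVneq c 0.
  by have [|t /w_u] := fixM w; rewrite // wM c0 scale0r addr0.
apply: (@stationary_no_jordan _ _ M u (c^-1 *: w) i0) => //.
by rewrite -scalemxAl wM scalerDr scalerA mulVf // scale1r.
Qed.

(** * The spectrum of the rate matrix *)

Section RateMatrix.
Variables (R : realType) (n : nat).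
Local Notation CC := R[i].
Local Notation normc := ComplexField.Normc.normc.

Lemma normcC (z : CC) : `|z| = ((normc z)%:C)%C.
Proof. by []. Qed.

Lemma Re_le_normc (z : CC) : complex.Re z <= normc z.
Proof.
by have := normc_ge_Re z; rewrite normcC lecR; apply: le_trans; exact: ler_norm.
Qed.

Variables (A B C L : 'M[R]_n) (E : pred 'I_n) (u : 'rV[R]_n).
Hypothesis lbABC : level_blocks A B C E.
Hypothesis lL : level_matrix A B E L.
Hypothesis eL : L = B - C *m invmx L *m A.
Hypothesis u_gt0 : mx_gt0 u.
Hypothesis uL : mx_le (u *m C) (u *m L).
Let Q := A - B + C.
Hypothesis Q_irr : mx_irreducible Q.
Hypothesis uQ : u *m Q = 0.
Hypothesis notE : exists i, ~~ E i.

Let RR := C *m invmx L.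

Let nL : nonsing_Mmx L.
Proof. exact: (level_matrix_nonsing lbABC lL). Qed.

Let RRL : RR *m L = C.
Proof. by rewrite mulmxKV ?nonsing_Mmx_unit. Qed.

Let BE : B = L + RR *m A.
Proof. by rewrite [in X in X + _]eL subrK. Qed.

Lemma rate_ge0 : mx_ge0 RR.
Proof. exact: mx_ge0_mul (lb_C_ge0 lbABC) (nonsing_Mmx_inv_ge0 nL). Qed.

Lemma rate_sub : mx_le (u *m RR) u.
Proof.
rewrite -[X in mx_le _ X](mulmxK (nonsing_Mmx_unit nL)) mulmxA.
exact: mx_le_mulr (nonsing_Mmx_inv_ge0 nL) uL.
Qed.

Lemma mxpolynomial3 (P0 P1 P2 : 'M[CC]_n) :
  mxpolynomial [:: P0; P1; P2] =
  map_mx polyC P0 + 'X *: map_mx polyC P1 + 'X^2 *: map_mx polyC P2.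
Proof.
by rewrite /mxpolynomial !big_ord_recl big_ord0 /= scale1r addr0 addrA.
Qed.

(** Both coefficients of the right factor come from [L = B - RR *m A], which is
    the fixed-point equation of the elimination, and [RR *m L = C]. *)
Lemma rate_factorization :
  mxpolynomial [:: cplx_mx C; - cplx_mx B; cplx_mx A]
  = char_poly_mx (cplx_mx RR) *m
    ('X *: map_mx polyC (cplx_mx A) - map_mx polyC (cplx_mx L)).
Proof.
rewrite mxpolynomial3 /char_poly_mx BE -{1}RRL.
rewrite /cplx_mx !(map_mxM, map_mxD, map_mxN) /=.
rewrite mulmxBl !mulmxBr !mul_scalar_mx -!scalemxAr scalerA -expr2.
rewrite scalerN scalerDr.
move: (_ *m map_mx _ (map_mx _ L)) (_ *m map_mx _ (map_mx _ A)) => rl ra.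
by apply/matrixP => i j; rewrite !mxE; ring.
Qed.

(** [L - z A] differs from [L - A], whose weighted row sums are nonnegative, on
    the diagonal only; for [Re z < 1] this makes the diagonal strictly dominant. *)
Lemma pencil_unit (z : CC) :
  complex.Re z < 1 -> z *: cplx_mx A - cplx_mx L \in unitmx.
Proof.
move=> z1; pose x i : R := level_weight R E i 0.
have x0 i : 0 < x i by exact: level_weight_gt0.
apply: (@dominant_unit _ _ _ (fun i => ((x i)%:C)%C)) => [i|i]; first by rewrite ltcR.
have -> : \sum_(j | j != i) `|(z *: cplx_mx A - cplx_mx L) i j| * ((x j)%:C)%C
        = ((\sum_(j | j != i) - L i j * x j)%:C)%C.
  rewrite rmorph_sum; apply: eq_bigr => j ji; rewrite rmorphM; congr (_ * _).
  rewrite !mxE (lb_A_diag lbABC) ?(eq_sym i) // mulr0 sub0r -rmorphN.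
  by rewrite ger0_norm // lecR oppr_ge0 (lm_Zmx lL) // eq_sym.
rewrite normcC -rmorphM ltcR.
have le_i : (L i i - complex.Re z * A i i) * x i <=
    normc ((z *: cplx_mx A - cplx_mx L) i i) * x i.
  rewrite ler_wpM2r ?(ltW (x0 _)) //.
  have := Re_le_normc (- (z *: cplx_mx A - cplx_mx L) i i).
  move=> Re_le; have -> : normc ((z *: cplx_mx A - cplx_mx L) i i)
      = normc (- (z *: cplx_mx A - cplx_mx L) i i).
    by apply: complexI; rewrite -!normcC normrN.
  apply: le_trans Re_le; rewrite !mxE; case: (z) => a b /=.
  by rewrite !mulr0 subr0; lra.
apply: lt_le_trans le_i.
under eq_bigr do rewrite mulNr.
rewrite sumrN; have := level_matrix_weight lbABC i lL.
rewrite (level_A_ones lbABC) [(L *m _) i 0]mxE (bigD1 i) //= -/(x i).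
under [in X in _ <= _ + X]eq_bigr do rewrite -/(x _).
set s := \sum_(_ | _) _; rewrite /x mxE; case: (boolP (E i)) => Ei.
  by rewrite (lb_A_eq0 lbABC) //; have := lb_B_gt0 lbABC Ei; lra.
by have := lb_A_gt0 lbABC Ei; nra.
Qed.

Lemma rate_eigenvalue_le1 (z : CC) : eigenvalue (cplx_mx RR) z -> `|z| <= 1.
Proof.
rewrite eigenvalue_root_char -char_poly_tr -eigenvalue_root_char /cplx_mx map_trmx.
apply: (@spectral_bound _ _ _ u^T 1) => [i j|i j|i j].
- by rewrite mxE; exact: rate_ge0.
- by rewrite mxE.
- by rewrite -trmx_mul scale1r mxE [leRHS]mxE; exact: rate_sub.
Qed.

Lemma generator_factorization : Q = (1%:M - RR) *m (A - L).
Proof.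
rewrite mulmxBl mul1mx mulmxBr RRL /Q [in LHS]BE; move: (RR *m A) => ra.
by apply/matrixP => i j; rewrite !mxE; ring.
Qed.

Lemma generator_offdiag i j : i != j -> 0 <= Q i j.
Proof.
move=> ij; rewrite /Q !mxE (lb_A_diag lbABC ij) sub0r addr_ge0 ?(lb_C_ge0 lbABC) //.
by rewrite oppr_ge0 (lb_B_Zmx lbABC).
Qed.

Lemma generator_ones : Q *m ones R n = 0.
Proof. by rewrite /Q addrAC mulmxBl (lb_row_sums lbABC) subrr. Qed.

Lemma rate_fixed (w : 'rV[R]_n) : w *m RR = w -> exists t, w = t *: u.
Proof.
move=> wR; apply: (irreducible_left_kernel generator_offdiag Q_irr u_gt0 uQ).
by rewrite generator_factorization mulmxA (mulmxBr w) mulmx1 wR subrr mul0mx.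
Qed.


Lemma rate_fixed_stationary : root (char_poly RR) 1 -> u *m RR = u.
Proof.
rewrite -eigenvalue_root_char => /eigenvalueP[w]; rewrite scale1r => wR w0.
have [t wu] := rate_fixed wR; have t0 : t != 0.
  by apply: contraNneq w0 => t0; rewrite wu t0 scale0r.
by apply: (scalerI t0); rewrite scalemxAl -wu.
Qed.

Let drift := (u *m (C - A) *m ones R n) 0 0.

Lemma driftE : drift = (u *m C *m ones R n) 0 0 - (u *m A *m ones R n) 0 0.
Proof. by rewrite /drift mulmxBr mulmxBl mxE [X in _ + X]mxE. Qed.

Lemma le_uA_uL : (u *m A *m ones R n) 0 0 <= (u *m L *m ones R n) 0 0.
Proof.
rewrite -!mulmxA; apply: mx_le_mull (lm_row_sums lL) _ _ => i j; exact/ltW/u_gt0.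
Qed.

(** An eigenvalue [1] would give [u RR = u], hence [u C 1 = u L 1 >= u A 1]. *)
Lemma rate_root1_neg : drift < 0 -> ~~ root (char_poly RR) 1.
Proof.
rewrite driftE subr_lt0; apply: contraTN => /rate_fixed_stationary uR.
by rewrite -leNgt -RRL mulmxA uR le_uA_uL.
Qed.

(** If [1] were not an eigenvalue, [0 = Q 1 = (I - RR) (A - L) 1] would force
    [L 1 = A 1], so that [u C 1 <= u L 1 = u A 1]; with a nonnegative drift these
    are equalities, hence [u C = u L], that is [u RR = u]. *)
Lemma rate_root1_ge0 : 0 <= drift ->
  exists2 p : {poly R}, char_poly RR = ('X - 1) * p & ~~ root p 1.
Proof.
move=> d0; have [i0 _] := notE.
apply: (@stationary_simple _ _ RR u i0 rate_ge0 u_gt0) => [|w]; last exact: rate_fixed.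
apply: rate_fixed_stationary; apply/negPn/negP => nroot.
have uIR : 1%:M - RR \in unitmx.
  rewrite -row_free_unit; apply: inj_row_free => w; rewrite mulmxBr mulmx1.
  move/eqP; rewrite subr_eq0 => /eqP wR; apply/eqP; apply: contraNT nroot => w0.
  by rewrite -eigenvalue_root_char; apply/eigenvalueP; exists w; rewrite ?scale1r.
have A1 : A *m ones R n = L *m ones R n.
  apply/eqP; rewrite -subr_eq0 -mulmxBl; apply/eqP.
  rewrite -[LHS](mulKmx uIR) (mulmxA (1%:M - RR)) -generator_factorization.
  by rewrite generator_ones mulmx0.
have uLC j : 0 <= (u *m L - u *m C) 0 j.
  by have /mx_leP := uL; apply.
have /eqP : \sum_j (u *m L - u *m C) 0 j = 0.
  apply/le_anti; rewrite sumr_ge0 // andbT -(mulmx_onesE _ _ 0) mulmxBl -mulmxA -A1 mulmxA.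
  by move: d0; rewrite driftE subr_ge0 -subr_le0 !mxE.
rewrite psumr_eq0 // => /allP uLC0.
have uCL : u *m C = u *m L.
  apply/esym/rowP => j; apply/eqP; have := uLC0 j (mem_index_enum j).
  by rewrite /= [X in X == 0]mxE [X in _ + X]mxE subr_eq0.
move/negP: nroot; apply; rewrite -eigenvalue_root_char; apply/eigenvalueP.
exists u; last by apply/rV0Pn; exists i0; rewrite gt_eqF.
by rewrite scale1r mulmxA uCL mulmxK // nonsing_Mmx_unit.
Qed.

(** For a left eigenvector [w] with [|z| = 1], taking moduli in
    [w (B - z A - z^-1 C) = 0] gives [(1 - Re z) |w j| A j j <= (|w| Q) j]; these
    quantities add up to [|w| Q 1 = 0].  So [|w| Q = 0], which makes [|w|] a
    multiple of [u], without zero entry, and [Re z = 1] follows from a phase with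
    [A j j > 0]. *)
Lemma rate_unit_circle (z : CC) :
  eigenvalue (cplx_mx RR) z -> `|z| = 1 -> z = 1.
Proof.
move=> /eigenvalueP[w wR w0] z1.
have z0 : z != 0 by rewrite -normr_gt0 z1.
have wC : w *m cplx_mx C = z *: (w *m cplx_mx B) - z ^+ 2 *: (w *m cplx_mx A).
  have -> : cplx_mx C = cplx_mx RR *m cplx_mx L by rewrite -cplx_mxM RRL.
  have -> : cplx_mx B = cplx_mx L + cplx_mx RR *m cplx_mx A.
    by rewrite -cplx_mxM -map_mxD -BE.
  rewrite mulmxDr !mulmxA wR.
  by rewrite -!scalemxAl scalerDr scalerA -expr2 addrK.
pose W : 'rV[R]_n := map_mx (fun x => normc x) w.
have W0 j : 0 <= W 0 j by rewrite mxE -lecR; exact: (normr_ge0 (w 0 j)).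
pose cz := 1 - complex.Re z.
have Re1 y : `|y : CC| = 1 -> complex.Re y <= 1.
  by rewrite normcC => -[y1]; rewrite -[leRHS]y1 Re_le_normc.
have cz0 : 0 <= cz by rewrite subr_ge0 Re1.
have key j : cz * (W 0 j * A j j) <= (W *m Q) 0 j.
  have wA : (w *m cplx_mx A) 0 j = w 0 j * (A j j)%:C%C.
    rewrite mxE (bigD1 j) //= big1 ?addr0 ?mxE // => i ij.
    by rewrite mxE (lb_A_diag lbABC ij) mulr0.
  have colj : w 0 j * ((B j j)%:C - z * (A j j)%:C - z^-1 * (C j j)%:C)%C
      = \sum_(i | i != j) w 0 i * (- (B i j)%:C + z^-1 * (C i j)%:C)%C.
    under eq_bigr do rewrite mulrDr mulrN mulrCA.
    rewrite big_split /= sumrN -mulr_sumr.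
    have : (w *m cplx_mx C) 0 j
           = z * (w *m cplx_mx B) 0 j - z ^+ 2 * (w *m cplx_mx A) 0 j.
      by rewrite wC mxE [X in X + _]mxE [X in _ + X]mxE [in X in _ + X]mxE.
    rewrite wA ![(w *m _) 0 j]mxE (bigD1 j) //= [X in z * X](bigD1 j) //= !mxE.
    under eq_bigr do rewrite mxE; under [in X in z * X]eq_bigr do rewrite mxE.
    set sC := \sum_(_ | _) _; set sB := \sum_(_ | _) _.
    move=> /(congr1 (fun y => z^-1 * y)) e.
    have -> : - sB + z^-1 * sC
            = z^-1 * (w 0 j * (C j j)%:C + sC)%C - sB - z^-1 * (w 0 j * (C j j)%:C)%C.
      by ring.
    by rewrite e; field.
  have le_sum : W 0 j * normc ((B j j)%:C - z * (A j j)%:C - z^-1 * (C j j)%:C)%C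
      <= \sum_(i | i != j) W 0 i * (- B i j + C i j).
    rewrite -lecR rmorphM rmorph_sum /= mxE -!normcC -normrM colj.
    apply: le_trans (ler_norm_sum _ _ _) _; apply: ler_sum => i ij.
    rewrite normrM rmorphM /= mxE -normcC ler_wpM2l //.
    apply: le_trans (ler_normD _ _) _; rewrite normrM normfV z1 invr1 mul1r.
    rewrite -rmorphN !ger0_norm ?rmorphD // lecR ?oppr_ge0 ?(lb_C_ge0 lbABC) //.
    by rewrite (lb_B_Zmx lbABC).
  have WQ : (W *m Q) 0 j = W 0 j * Q j j + \sum_(i | i != j) W 0 i * (- B i j + C i j).
    rewrite mxE (bigD1 j) //=; congr (_ + _); apply: eq_bigr => i ij.
    by congr (_ * _); rewrite !mxE (lb_A_diag lbABC ij) sub0r.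
  rewrite WQ; have -> : Q j j = A j j - B j j + C j j by rewrite !mxE.
  suff : W 0 j * (B j j - C j j - complex.Re z * A j j)
         <= W 0 j * normc ((B j j)%:C - z * (A j j)%:C - z^-1 * (C j j)%:C)%C.
    by rewrite /cz; lra.
  rewrite ler_wpM2l //; apply: le_trans (Re_le_normc _).
  have Rez1 : complex.Re z^-1 <= 1 by apply: Re1; rewrite normfV z1 invr1.
  have := lb_C_ge0 lbABC j j; move: Rez1; case: (z^-1) => a1 b1 /=.
  by case: (z) => a b /=; rewrite !mulr0 !subr0; nra.
have WQ0 j : (W *m Q) 0 j = 0.
  have : \sum_j (W *m Q) 0 j = 0.
    by rewrite -(mulmx_onesE _ _ 0) -mulmxA generator_ones mulmx0 mxE.
  move/eqP; rewrite psumr_eq0 => [/allP/(_ j (mem_index_enum j))/eqP //|k _].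
  by apply: le_trans (key k); rewrite !mulr_ge0 // (lb_A_ge0 lbABC).
have [t Wt] : exists t, W = t *: u.
  apply: (irreducible_left_kernel generator_offdiag Q_irr u_gt0 uQ).
  by apply/rowP => j; rewrite WQ0 mxE.
have [j nEj] := notE.
have t0 : t != 0.
  apply: contraNneq w0 => t0; apply/eqP/rowP => k; rewrite [RHS]mxE.
  by apply/ComplexField.Normc.eq0_normc; have /rowP/(_ k) := Wt; rewrite !mxE t0 mul0r.
have Wj : 0 < W 0 j.
  by rewrite lt_neqAle W0 andbT eq_sym Wt mxE mulf_neq0 // gt_eqF.
have Rez : complex.Re z = 1.
  apply/le_anti; rewrite Re1 //= -subr_le0 -/cz.
  have := key j; rewrite WQ0 mulrA pmulr_lle0 ?(lb_A_gt0 lbABC) //.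
  by rewrite pmulr_lle0.
move: z1 Rez; rewrite normc_def; case: (z) => a b /= [] e ea.
have : b ^+ 2 = 0.
  have := congr1 (fun y => y ^+ 2) e; rewrite sqr_sqrtr ?addr_ge0 ?sqr_ge0 //.
  by rewrite ea expr1n => /eqP; rewrite -subr_eq0 addrAC subrr add0r => /eqP.
by move/eqP; rewrite sqrf_eq0 => /eqP ->; rewrite ea.
Qed.

End RateMatrix.

(** * Invariant pairs *)

(** With [U] the factor on the right, the change of basis whose first rows are [U]
    makes [K *m U] block triangular, with diagonal blocks [U *m K] and [0]. *)
Lemma char_poly_mulmx_row1 (F : fieldType) m k
    (K : 'M[F]_(m + k, m)) (Psi : 'M[F]_(m, k)) :
  char_poly (K *m row_mx 1%:M Psi) = char_poly (row_mx 1%:M Psi *m K) * 'X^k.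
Proof.
set U := row_mx 1%:M Psi.
pose T : 'M[F]_(m + k) := block_mx 1%:M Psi 0 1%:M.
pose N : 'M[F]_(m + k) := block_mx (U *m K) 0 (dsubmx K) 0.
have uT : T \in unitmx by rewrite unitmxE det_ublock !det1 mulr1 unitr1.
have TK : T *m K = col_mx (U *m K) (dsubmx K).
  by rewrite -{1 2}[K]vsubmxK /T mul_block_col mul_row_col mul0mx !mul1mx add0r.
have NT : N *m T = T *m (K *m U).
  rewrite mulmxA TK mul_col_mx /U !mul_mx_row !mulmx1.
  by rewrite /N /T mulmx_block !mulmx0 !mul0mx !mulmx1 !addr0.
rewrite (char_poly_sim uT NT) char_poly_lblock; congr (_ * _).
by rewrite /char_poly /char_poly_mx map_mx0 subr0 det_scalar.
Qed.

Lemma left_invariant_pair2 (R : realType) m n (P0 P1 P2 : 'M[R]_n)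
    (X : 'M[R]_m) (U : 'M[R]_(m, n)) :
  row_free U -> U *m P0 + X *m U *m P1 + X *m X *m U *m P2 = 0 ->
  left_invariant_pair [:: cplx_mx P0; cplx_mx P1; cplx_mx P2] (cplx_mx X) (cplx_mx U).
Proof.
move=> fU XU; split.
  rewrite !big_ord_recl big_ord0 /= addr0 expr0 expr1 expr2 mul1mx.
  have -> : 0 = cplx_mx (U *m P0 + X *m U *m P1 + X *m X *m U *m P2).
    by rewrite XU /cplx_mx map_mx0.
  by rewrite /cplx_mx !(map_mxD, map_mxM) /= addrA.
apply: inj_row_free => v; rewrite mul_mxrow => /eqP.
rewrite -[0](mxrow0) => /eqP/eq_mxrowP/(_ ord0).
rewrite expr0 mul1mx => vU; apply/eqP.
rewrite -(@mulmx_free_eq0 _ _ _ _ v (cplx_mx U)) ?vU //.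
by rewrite row_free_map.
Qed.

(** The columns of [P((y - 1) / h)], the last [k] of them multiplied by [y], which
    requires that [V] vanish there; [A], [- B] and [C] are the coefficients. *)
Record shifted_columns (R : realType) m k (A B C V D Q : 'M[R]_(m + k)) (h : R) :
    Prop := ShiftedColumns {
  shifted_A_l : lsubmx A = h ^- 2 *: lsubmx V;
  shifted_A_r : rsubmx A = - (h^-1 *: rsubmx D);
  shifted_B_l : lsubmx B = 2 *: (h ^- 2 *: lsubmx V) + h^-1 *: lsubmx D;
  shifted_B_r : rsubmx B = - (h^-1 *: rsubmx D) - rsubmx Q;
  shifted_C_l : lsubmx C = h ^- 2 *: lsubmx V + h^-1 *: lsubmx D + lsubmx Q;
  shifted_C_r : rsubmx C = 0;
  shifted_V_r : rsubmx V = 0 }.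

Section Pairs.
Variables (R : realType) (m k : nat).
Local Notation CC := R[i].
Variables (A B C V D Q : 'M[R]_(m + k)) (E : pred 'I_(m + k)) (h : R).
Variable (u : 'rV[R]_(m + k)).
Hypothesis lbABC : level_blocks A B C E.
Hypothesis h_gt0 : 0 < h.
Hypothesis cols : shifted_columns A B C V D Q h.
Hypothesis u_gt0 : mx_gt0 u.
Hypothesis Q_irr : mx_irreducible Q.
Hypothesis uQ : u *m Q = 0.
Hypothesis notE : exists i, ~~ E i.

Let A_l := shifted_A_l cols.
Let A_r := shifted_A_r cols.
Let B_l := shifted_B_l cols.
Let B_r := shifted_B_r cols.
Let C_l := shifted_C_l cols.
Let C_r := shifted_C_r cols.
Let V_r := shifted_V_r cols.

Let L := Bhat_inf A B C.
Let B12 := ursubmx L.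
Let B21 := dlsubmx L.
Let B22 := drsubmx L.
Let Psi := - (B12 *m invmx B22).
Let S := ulsubmx L + Psi *m B21.
Let Y := (ulsubmx C + Psi *m dlsubmx C) *m invmx S.
Let X := h^-1 *: (Y - 1%:M).
Let U : 'M[R]_(m, m + k) := row_mx 1%:M Psi.
Let RR := C *m invmx L.
Let K := lsubmx C *m invmx S.

Lemma shifted_generator : A - B + C = Q.
Proof.
rewrite -[A]hsubmxK -[B]hsubmxK -[C]hsubmxK -[Q]hsubmxK.
rewrite opp_row_mx !add_row_mx A_l A_r B_l B_r C_l C_r; congr row_mx.
all: by apply/matrixP => i j; rewrite !mxE; ring.
Qed.

Let lL : level_matrix A B E L.
Proof. exact: (level_limit lbABC).1. Qed.

Let nL : nonsing_Mmx L.
Proof. exact: (level_matrix_nonsing lbABC lL). Qed.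

Lemma pair_signs : [/\ nonsing_Mmx B22, mx_ge0 Psi & nonsing_Mmx S].
Proof. by have [] := nonsing_Mmx_schur nL; rewrite /S /Psi mulNmx. Qed.

Lemma pair_mulL : U *m L = row_mx S 0.
Proof.
have [n22 _ _] := pair_signs.
rewrite -{1}[L]submxK mul_row_block !mul1mx; congr row_mx.
by rewrite /Psi mulNmx mulmxKV ?subrr // nonsing_Mmx_unit.
Qed.

Let uS : S \in unitmx.
Proof. by apply: nonsing_Mmx_unit; have [] := pair_signs. Qed.

(** [U *m L = row_mx S 0] and the last columns of [C] vanish, so that
    [K *m U *m L = row_mx (lsubmx C) 0 = C]. *)
Lemma rate_pairE : RR = K *m U.
Proof.
rewrite -[RHS](mulmxK (nonsing_Mmx_unit nL)) -(mulmxA K) pair_mulL mul_mx_row mulmx0.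
by rewrite mulmxKV // -C_r hsubmxK.
Qed.

Lemma pair_YE : Y = U *m K.
Proof.
rewrite mulmxA /Y; congr (_ *m _).
by rewrite -[C in RHS]submxK block_mxEh row_mxKl mul_row_col mul1mx.
Qed.

Lemma pair_mul_rate : U *m RR = Y *m U.
Proof. by rewrite rate_pairE pair_YE mulmxA. Qed.

Lemma U_free : row_free U.
Proof.
apply: inj_row_free => v; rewrite mul_mx_row mulmx1 -[0]hsubmxK.
by move=> /eq_row_mx[-> _]; rewrite linear0.
Qed.

Lemma pair_mulB : U *m B = U *m L + Y *m U *m A.
Proof.
rewrite -pair_mul_rate -mulmxA -mulmxDr; congr (_ *m _); apply/eqP.
by rewrite -subr_eq eq_sym; apply/eqP; exact: (level_limit lbABC).2.
Qed.

Lemma pair_mulC : U *m C = Y *m (U *m L).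
Proof. by rewrite mulmxA -pair_mul_rate -mulmxA mulmxKV // nonsing_Mmx_unit. Qed.

Lemma pair_F : U *m C + Y *m U *m - B + Y *m Y *m U *m A = 0.
Proof.
rewrite mulmxN -(mulmxA Y U B) pair_mulB pair_mulC mulmxDr opprD addrA subrr add0r.
by rewrite !mulmxA addNr.
Qed.

(** The columns outside [E3] are those of the equation for [Y]; in the columns of
    [E3] that equation carries an additional factor [Y], and one uses instead that
    [U *m L = row_mx S 0] vanishes there. *)
Lemma pair_P : U *m Q + X *m U *m - D + X *m X *m U *m V = 0.
Proof.
have h0 : h != 0 by rewrite gt_eqF.
have UAr := congr1 rsubmx pair_mulB; have F_l := congr1 lsubmx pair_F.
rewrite pair_mulL [rsubmx (_ + _)]linearD /= row_mxKr add0r in UAr.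
have lE (M : 'M[R]_(m, m + k)) N : lsubmx (M *m N) = M *m lsubmx N.
  by rewrite -{1}[N]hsubmxK mul_mx_row row_mxKl.
have rE (M : 'M[R]_(m, m + k)) N : rsubmx (M *m N) = M *m rsubmx N.
  by rewrite -{1}[N]hsubmxK mul_mx_row row_mxKr.
rewrite -[LHS]hsubmxK !linearD /= !lE !rE V_r !mulmx0 addr0 /=.
rewrite !linearD /= !lE !linearN /= in F_l; rewrite !rE in UAr.
have XU (M : 'M[R]_(m, m + k)) : X *m M = h^-1 *: (Y *m M - M).
  by rewrite -scalemxAl mulmxBl mul1mx.
have XXU : X *m X *m U = h ^- 2 *: (Y *m Y *m U - 2 *: (Y *m U) + U).
  rewrite -mulmxA !XU -scalemxAr !mulmxBr scalerBr scalerA -expr2 exprVn.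
  rewrite mulmxA; apply/matrixP => i j; rewrite !mxE; field; exact: h0.
rewrite XXU XU !linearN /= -[0]hsubmxK; congr row_mx.
  rewrite -F_l A_l B_l C_l !(mulmxDr, mulmxDl, mulmxBl, mulmxN, mulNmx) -!scalemxAl.
  rewrite -!scalemxAr !(mulmxDl, mulNmx) -!scalemxAl.
  move: (U *m lsubmx V) (Y *m U *m lsubmx V) (Y *m Y *m U *m lsubmx V)
    (U *m lsubmx D) (Y *m U *m lsubmx D) (U *m lsubmx Q) => a b c d e f.
  by apply/matrixP => i j; rewrite !mxE; ring.
rewrite linear0; rewrite B_r A_r mulmxBr !mulmxN -!scalemxAr in UAr.
rewrite -scalemxAl mulmxBl scalerBr.
move: UAr; move: (U *m rsubmx D) (Y *m U *m rsubmx D) (U *m rsubmx Q) => a b c e.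
apply/matrixP => i j; have /matrixP/(_ i j) := e; rewrite !mxE; lra.
Qed.

Lemma drift_shift : (u *m (C - A) *m ones R (m + k)) 0 0
  = h^-1 * (u *m D *m ones R (m + k)) 0 0.
Proof.
have -> : u *m (C - A) = h^-1 *: (u *m D).
  have uQl : u *m lsubmx Q = 0.
    have := congr1 lsubmx uQ; rewrite -{1}[Q]hsubmxK mul_mx_row row_mxKl => ->.
    by rewrite linear0.
  rewrite -[C]hsubmxK -[A]hsubmxK opp_row_mx add_row_mx C_l A_l C_r A_r.
  rewrite -{3}[D]hsubmxK !mul_mx_row scale_row_mx; congr row_mx.
    by rewrite addrAC [_ + _ *: _ - _]addrAC subrr add0r mulmxDr uQl addr0 scalemxAr.
  by rewrite sub0r opprK scalemxAr.
by rewrite -scalemxAl mxE.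
Qed.

Lemma mxpolynomial_shift :
  mxpolynomial [:: cplx_mx C; - cplx_mx B; cplx_mx A]
  = map_mx (comp_poly ((h^-1)%:C%C *: ('X - 1)))
      (mxpolynomial [:: cplx_mx Q; - cplx_mx D; cplx_mx V])
    *m block_mx 1%:M 0 0 'X%:M.
Proof.
have El (M : 'M[R]_(m + k)) N : lsubmx M = N -> forall i j, M i (lshift k j) = N i j.
  by move=> <- i j; rewrite mxE.
have Er (M : 'M[R]_(m + k)) N : rsubmx M = N -> forall i j, M i (rshift m j) = N i j.
  by move=> <- i j; rewrite mxE.
rewrite !mxpolynomial3 -[map_mx (comp_poly _) _]hsubmxK mul_row_block.
rewrite !mulmx0 addr0 add0r mulmx1 mul_mx_scalar -[LHS]hsubmxK.
congr row_mx; apply/matrixP => i j; rewrite !mxE.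
  rewrite (El _ _ A_l) (El _ _ B_l) (El _ _ C_l) !mxE -exprVn.
  rewrite !(comp_polyD, comp_polyM, comp_polyX, comp_polyC) /=.
  rewrite !(rmorphD, rmorphM, rmorphN, rmorphXn, rmorph_nat) /= -?mul_polyC.
  ring.
rewrite (Er _ _ A_r) (Er _ _ B_r) (Er _ _ C_r) (Er _ _ V_r) !mxE.
rewrite !(comp_polyD, comp_polyM, comp_polyX, comp_polyC) /=.
rewrite !(rmorphD, rmorphM, rmorphN, rmorphXn, rmorph_nat, rmorph0) /= -mul_polyC.
ring.
Qed.

Let H : {poly CC} :=
  \det ('X *: map_mx polyC (cplx_mx A) - map_mx polyC (cplx_mx L)).

Lemma pencil_nonroot (z : CC) : complex.Re z < 1 -> ~~ root H z.
Proof.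
move=> z1; rewrite /root -horner_evalE -det_map_mx -unitfE -unitmxE.
rewrite [map_mx _ _](_ : _ = z *: cplx_mx A - cplx_mx L).
  exact: pencil_unit lbABC lL _ z1.
by apply/matrixP => i j; rewrite [LHS]mxE /= /horner_eval !mxE !hornerE mulrC.
Qed.

Lemma rate_char_polyE : char_poly (cplx_mx RR) = char_poly (cplx_mx Y) * 'X^k.
Proof.
have -> : cplx_mx RR = cplx_mx K *m row_mx 1%:M (cplx_mx Psi).
  by rewrite rate_pairE cplx_mxM /cplx_mx map_row_mx map_scalar_mx.
rewrite char_poly_mulmx_row1; congr (char_poly _ * _).
by rewrite pair_YE cplx_mxM /cplx_mx [in RHS]map_row_mx map_scalar_mx.
Qed.

Lemma det_F : \det (mxpolynomial [:: cplx_mx C; - cplx_mx B; cplx_mx A])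
  = char_poly (cplx_mx Y) * 'X^k * H.
Proof.
rewrite (rate_factorization lbABC lL (level_limit lbABC).2).
by rewrite det_mulmx -rate_char_polyE.
Qed.

(** Both determinants carry the factor ['X^k]: on one side it stands for the [k]
    zero eigenvalues of the rate matrix, on the other for the [k] columns
    multiplied by [y]. *)
Lemma det_P :
  \det (mxpolynomial [:: cplx_mx Q; - cplx_mx D; cplx_mx V])
    \Po ((h^-1)%:C%C *: ('X - 1)) = char_poly (cplx_mx Y) * H.
Proof.
have Xk0 : 'X^k != 0 :> {poly CC} by rewrite -size_poly_eq0 size_polyXn.
apply: (mulIf Xk0); rewrite mulrAC -det_F mxpolynomial_shift det_mulmx det_map_mx.
by rewrite det_ublock det1 mul1r det_scalar.
Qed.

Let d := (u *m (C - A) *m ones R (m + k)) 0 0.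

(** The nonzero eigenvalues of [Y] are those of the rate matrix: none exceeds [1]
    in modulus, only [1] can have modulus [1], and the sign of the drift decides
    whether [1] is an eigenvalue, which is then simple. *)
Lemma pair_spectrum : exists s : seq CC,
  eigenvalues_are (cplx_mx Y) (if d < 0 then s else 1 :: s) /\
  forall z, z \in s -> `|z| < 1.
Proof.
have eL := (level_limit lbABC).2; rewrite -/L in eL.
have Q_irr' : mx_irreducible (A - B + C) by rewrite shifted_generator.
have uQ' : u *m (A - B + C) = 0 by rewrite shifted_generator.
have uL : mx_le (u *m C) (u *m L).
  apply: (level_limit_stationary lbABC u_gt0).
  by apply/eqP; rewrite eq_sym -subr_eq0 -mulmxBr addrAC uQ'.
have [s0 cY] := closed_field_poly_normal (char_poly (cplx_mx Y)).
rewrite (monicP (char_poly_monic _)) scale1r in cY.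
have cR : char_poly (cplx_mx RR) = (\prod_(z <- s0) ('X - z%:P)) * 'X^k.
  by rewrite rate_char_polyE cY.
have s0_eig z : z \in s0 -> eigenvalue (cplx_mx RR) z.
  by move=> zs; rewrite eigenvalue_root_char cR rootM root_prod_XsubC zs.
have s0_lt1 z : z \in s0 -> z != 1 -> `|z| < 1.
  move=> zs z1.
  rewrite lt_neqAle (rate_eigenvalue_le1 lbABC lL u_gt0 uL (s0_eig _ zs)) andbT.
  apply: contraNneq z1 => z1.
  by apply/eqP; exact: (rate_unit_circle lbABC lL eL u_gt0 Q_irr' uQ' notE (s0_eig _ zs)).
have cRR : char_poly (cplx_mx RR) = map_poly (real_complex R) (char_poly RR).
  by rewrite map_char_poly.
case: ltP => d0.
  exists s0; split=> // z zs; apply: s0_lt1 => //; apply/eqP => z1.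
  have := rate_root1_neg lbABC lL eL u_gt0 Q_irr' uQ' d0.
  move/negP; apply; have := s0_eig _ zs; rewrite z1 eigenvalue_root_char cRR.
  by rewrite -{1}(rmorph1 (real_complex R)) fmorph_root.
have [p cRp p1] := rate_root1_ge0 lbABC lL eL u_gt0 uL Q_irr' uQ' notE d0.
have s01 : 1 \in s0.
  have : root (char_poly (cplx_mx RR)) 1.
    rewrite cRR -{1}(rmorph1 (real_complex R)) fmorph_root cRp rootM.
    by rewrite -polyC1 root_XsubC eqxx.
  by rewrite cR rootM root_prod_XsubC rootE hornerXn expr1n oner_eq0 orbF.
exists (rem 1 s0); have perm_s0 := perm_to_rem s01; split.
  by rewrite /eigenvalues_are cY; apply: perm_big.
move=> z zs; apply: s0_lt1; first exact: mem_rem zs.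
apply: contraNneq p1 => z1; rewrite -(fmorph_root (real_complex R)) rmorph1.
have : map_poly (real_complex R) p = (\prod_(z <- rem 1 s0) ('X - z%:P)) * 'X^k.
  have X10 : 'X - 1%:P != 0 :> {poly CC} by rewrite polyXsubC_eq0.
  apply: (mulfI X10); rewrite mulrA -(big_cons _ _ 1 _ xpredT (fun z => 'X - z%:P)).
  rewrite -(perm_big _ perm_s0) /= -cR cRR cRp rmorphM rmorphB /=.
  by rewrite map_polyX !rmorph1.
by move=> ->; rewrite z1 in zs; rewrite rootM root_prod_XsubC zs.
Qed.

(** ** Multiplicities *)

Section Counting.
Variable s : seq CC.
Hypothesis Ys : eigenvalues_are (cplx_mx Y) s.

Lemma count_F (z : CC) : complex.Re z < 1 ->
  finite_eig_mult [:: cplx_mx C; - cplx_mx B; cplx_mx A] z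
  = count_mem z (s ++ nseq k 0).
Proof.
move=> z1; rewrite /finite_eig_mult det_F mupMl ?pencil_nonroot // (Ys : _ = _).
have -> : 'X^k = \prod_(z <- nseq k (0 : CC)) ('X - z%:P).
  rewrite big_nseq subr0 -[LHS]mulr1.
  by elim: k => [|l /= <-]; rewrite ?expr0 ?exprS ?mulr1.
by rewrite -big_cat mu_prod_XsubC.
Qed.

Let f (z : CC) := (z - 1) / (h%:C)%C.
Let hC0 : (h%:C)%C != 0 :> CC.
Proof. by rewrite (fmorph_eq0 (real_complex R)) gt_eqF. Qed.

Lemma Re_shift (z : CC) : complex.Re (1 + (h%:C)%C * z) = 1 + h * complex.Re z.
Proof. by case: z => a b /=; rewrite mul0r subr0. Qed.

Lemma prod_shift : (\prod_(z <- s) ('X - z%:P)) \Po (1 + (h%:C)%C *: 'X)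
  = ((h%:C)%C ^+ size s)%:P * \prod_(z <- map f s) ('X - z%:P).
Proof.
rewrite rmorph_prod /= big_map rmorphXn /=.
elim: s => [|z s' IHs]; first by rewrite !big_nil expr0 mulr1.
rewrite !big_cons IHs exprS -!mulrA; rewrite mulrCA [RHS]mulrCA; congr (_ * _).
rewrite comp_polyB comp_polyX comp_polyC mulrA; congr (_ * _).
rewrite /f mulrBr -polyCM mulrCA divff // mulr1 polyCB -mul_polyC; ring.
Qed.

(** The half-plane [Re z < 0] is mapped onto [Re y < 1], which contains the open
    unit disk and still no root of the pencil [H]. *)
Lemma count_P (z : CC) : complex.Re z < 0 ->
  finite_eig_mult [:: cplx_mx Q; - cplx_mx D; cplx_mx V] z = count_mem z (map f s).
Proof.
move=> z0; rewrite /finite_eig_mult.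
set p := \det _; have -> : p = ((h%:C)%C ^+ size s)%:P *
    ((\prod_(z <- map f s) ('X - z%:P)) * (H \Po (1 + (h%:C)%C *: 'X))).
  rewrite mulrA -prod_shift -comp_polyM -(Ys : _ = _) -det_P -/p -comp_polyA.
  rewrite comp_polyZ comp_polyB comp_polyX -[1 in X in _ \Po X]polyC1 comp_polyC.
  by rewrite polyC1 addrAC subrr add0r scalerA fmorphV mulVf // scale1r comp_polyXr.
rewrite mupMr ?rootC ?expf_neq0 // mupMl ?mu_prod_XsubC //.
rewrite /root horner_comp !hornerE; apply: pencil_nonroot.
by rewrite Re_shift gtrDl pmulr_rlt0.
Qed.

Lemma X_eigenvalues : eigenvalues_are (cplx_mx X) (map f s).
Proof.
have hs0 : ((h%:C)%C ^+ size s)%:P != 0 :> {poly CC} by rewrite polyC_eq0 expf_neq0.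
have sizes : size s = m.
  by have := size_char_poly (cplx_mx Y); rewrite Ys size_prod_XsubC => -[].
apply: (mulfI hs0); rewrite -prod_shift -(Ys : _ = _) sizes.
rewrite /char_poly -det_map_mx rmorphXn /= -detZ; congr (\det _).
apply/matrixP => i j; rewrite !mxE; move: (\sum_(_ | _) _) => y.
have -> : (h^-1 * (y - (i == j)%:R))%:C%C = (h%:C)%C^-1 * (y - (i == j)%:R)%:C%C.
  by rewrite rmorphM fmorphV.
rewrite mulrBr -polyCM mulVKf // rmorphB polyCB.
rewrite comp_polyB comp_polyC; case: (i == j); rewrite ?mulr1n ?mulr0n.
  by rewrite comp_polyX mul_polyC !rmorph1; ring.
by rewrite mulr0 comp_poly0 !rmorph0; ring.
Qed.

End Counting.

End Pairs.

(** * Subtraction-free formulas *)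

Lemma subfree_mul (R : realType) (I : nat -> nat -> Type)
    (env : forall m n, I m n -> 'M[R]_(m, n))
    (known : forall m n, I m n -> 'I_m -> 'I_n -> bool)
    m n p (e : mexpr I m n) (f : mexpr I n p) i j :
  (forall l, subfree env known e i l) -> (forall l, subfree env known f l j) ->
  (forall l, 0 <= meval env e i l * meval env f l j) \/
  (forall l, meval env e i l * meval env f l j <= 0) ->
  subfree env known (MMul e f) i j.
Proof.
move=> se sf s0; split=> [l|a b]; first by split.
by case: s0 => s0; [rewrite mulr_ge0 | rewrite mulr_le0].
Qed.

Lemma subfree_opp (R : realType) (I : nat -> nat -> Type)
    (env : forall m n, I m n -> 'M[R]_(m, n))
    (known : forall m n, I m n -> 'I_m -> 'I_n -> bool)
    m n (e : mexpr I m n) i j :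
  subfree env known e i j -> subfree env known (MOpp e) i j.
Proof. by []. Qed.

Section SubFree.
Variables (R : realType) (m k : nat).
Variables (A B C : 'M[R]_(m + k)) (E : pred 'I_(m + k)) (h : R).
Hypothesis lbABC : level_blocks A B C E.
Hypothesis h_gt0 : 0 < h.

Let L := Bhat_inf A B C.
Let w := Bhat_inf_w A B C.
Let Psi := - (ursubmx L *m invmx (drsubmx L)).
Let S := ulsubmx L + Psi *m dlsubmx L.
Let Y := (ulsubmx C + Psi *m dlsubmx C) *m invmx S.
Let X := h^-1 *: (Y - 1%:M).
Let env := cr_env L w C h.
Let known := @cr_known (m + k).

Let lL : level_matrix A B E L.
Proof. exact: (level_limit lbABC).1. Qed.

Let signs : [/\ nonsing_Mmx (drsubmx L), mx_ge0 Psi & nonsing_Mmx S].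
Proof. exact: pair_signs lbABC. Qed.

Let ur_le0 i j : ursubmx L i j <= 0.
Proof. by rewrite mxE mxE (lm_Zmx lL) // eq_lrshift. Qed.

Let dl_le0 i j : dlsubmx L i j <= 0.
Proof. by rewrite mxE mxE (lm_Zmx lL) // eq_rlshift. Qed.

Let w_ge0 : mx_ge0 w.
Proof.
rewrite /w -(level_limit_row_sums lbABC) => i j; apply: le_trans (lm_row_sums lL i j).
exact: mx_ge0_mul (lb_A_ge0 lbABC) (@mx_ge0_ones _ _) i j.
Qed.

Lemma pair_Y_ge0 : mx_ge0 Y.
Proof.
have [_ Psi0 nS] := signs; have C0 := lb_C_ge0 lbABC.
apply: mx_ge0_mul (nonsing_Mmx_inv_ge0 nS); apply: mx_ge0_add => [i j|].
  by rewrite !mxE.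
by apply: mx_ge0_mul => // i j; rewrite !mxE.
Qed.

Let wE : col_mx (usubmx w) (dsubmx w) = L *m col_mx (ones R m) (ones R k).
Proof.
rewrite vsubmxK /w -(level_limit_row_sums lbABC); congr (_ *m _).
by rewrite /ones col_mx_const.
Qed.

Let w1E : usubmx w = ulsubmx L *m ones R m + ursubmx L *m ones R k.
Proof. by have := wE; rewrite -{1}[L]submxK mul_block_col => /eq_col_mx[]. Qed.

Let w2E : dsubmx w = dlsubmx L *m ones R m + drsubmx L *m ones R k.
Proof. by have := wE; rewrite -{1}[L]submxK mul_block_col => /eq_col_mx[]. Qed.

Let B21_ones_le0 i j : (dlsubmx L *m ones R m) i j <= 0.
Proof. by rewrite mulmx_onesE sumr_le0. Qed.

Lemma Psi_subfree i j : subfree env known (Psi_e m k) i j.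
Proof.
have [n22 Psi0 _] := signs; have iB22 := nonsing_Mmx_inv_ge0 n22.
apply: subfree_opp; apply: subfree_mul => [l|l|]; first by rewrite /= eq_lrshift.
- split.
  + by move=> a b ab; rewrite /= eq_rshift.
  + move=> a; split=> //; split=> //; last first.
      apply: mulr_ge0; first by rewrite mxE; exact: w_ge0.
      by rewrite mxE oppr_ge0; exact: B21_ones_le0.
    apply: subfree_opp; apply: subfree_mul => //; first by move=> l'; rewrite /= eq_rlshift.
    by right=> l'; apply: mulr_le0_ge0; [exact: dl_le0 | exact: mx_ge0_ones].
  + exact: nonsing_Mmx_Mmatrix.
  + exact: nonsing_Mmx_unit.
  + have eqw : drsubmx L *m ones R k = dsubmx w - dlsubmx L *m ones R m.
      by rewrite w2E addrAC subrr add0r.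
    split=> //; first by move=> a b; rewrite mxE.
    move=> a b; rewrite [_ a b]mxE addr_ge0 //; first by rewrite mxE w_ge0.
    by rewrite mxE oppr_ge0.
- by right=> l; apply: mulr_le0_ge0; [exact: ur_le0 | exact: iB22].
Qed.

Lemma S_subfree i j : i != j -> subfree env known (S_e m k) i j.
Proof.
have [_ Psi0 _] := signs => ij; split; first by rewrite /= eq_lshift.
  apply: subfree_mul => [l|l|]; [exact: Psi_subfree | by rewrite /= eq_rlshift |].
  by right=> l; apply: mulr_ge0_le0; [exact: Psi0 | exact: dl_le0].
rewrite mulr_le0 //; first by rewrite mxE mxE (lm_Zmx lL) // eq_lshift.
by rewrite mxE sumr_le0 // => l _; apply: mulr_ge0_le0; [exact: Psi0 | exact: dl_le0].
Qed.

Lemma Y_subfree i j : subfree env known (Y_e m k) i j.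
Proof.
have [n22 Psi0 nS] := signs; have C0 := lb_C_ge0 lbABC.
have C11_0 a b : 0 <= ulsubmx C a b by rewrite !mxE.
have C21_0 a b : 0 <= dlsubmx C a b by rewrite !mxE.
have PsiC a b : 0 <= (Psi *m dlsubmx C) a b by apply: mx_ge0_mul.
have Psiw a b : 0 <= (Psi *m dsubmx w) a b.
  by apply: mx_ge0_mul => // c e; rewrite mxE; exact: w_ge0.
have iS := nonsing_Mmx_inv_ge0 nS.
apply: subfree_mul => [l|l|].
- split=> //; last by apply: mulr_ge0; [exact: C11_0 | exact: PsiC].
  apply: subfree_mul => // [a|]; first exact: Psi_subfree.
  by left=> a; apply: mulr_ge0; [exact: Psi0 | exact: C21_0].
- split.
  + by move=> a b; exact: S_subfree.
  + move=> a; split=> //; split=> //; last first.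
      by apply: mulr_ge0; [rewrite mxE; exact: w_ge0 | exact: Psiw].
    apply: subfree_mul => // [b|]; first exact: Psi_subfree.
    by left=> b; apply: mulr_ge0; [exact: Psi0 | rewrite mxE; exact: w_ge0].
  + exact: nonsing_Mmx_Mmatrix.
  + exact: nonsing_Mmx_unit.
  + split; first by move=> a b; rewrite mxE.
      by move=> a b; rewrite [_ a b]mxE; apply: addr_ge0;
        [rewrite mxE; exact: w_ge0 | exact: Psiw].
    have PsiM : Psi *m drsubmx L = - ursubmx L.
      by rewrite /Psi mulNmx mulmxKV // nonsing_Mmx_unit.
    rewrite [RHS](_ : _ = usubmx w + Psi *m dsubmx w) //.
    rewrite [LHS](_ : _ = S *m ones R m) // w1E w2E /S mulmxDl mulmxDr !mulmxA PsiM.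
    by rewrite (mulNmx (ursubmx L)) addrACA subrr addr0.
- left=> l; apply: mulr_ge0; last exact: iS.
  by rewrite [_ i l]mxE; apply: addr_ge0; [exact: C11_0 | exact: PsiC].
Qed.

Lemma IPsi_subfree : subfree_expr env known (IPsi_e m k) (row_mx 1%:M Psi).
Proof. by split=> // i j /=; case: split => // l; exact: Psi_subfree. Qed.

Lemma Y_subfree_expr : subfree_expr env known (Y_e m k) Y.
Proof. by split=> // i j; exact: Y_subfree. Qed.

Lemma X_subfree_expr : (forall z, eigenvalue (cplx_mx Y) z -> `|z| <= 1) ->
  subfree_offdiag_expr env known (X_e m k) X.
Proof.
move=> Y1; have hi0 : 0 < h^-1 by rewrite invr_gt0.
have h0 : h != 0 by rewrite gt_eqF.
have hC : 0 < (h%:C)%C :> R[i] by rewrite ltcR.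
split.
- by rewrite /= mxE eqxx mulr1n.
- exists h^-1, (h^-1 *: Y); split.
  + by move=> i j; rewrite mxE mulr_ge0 ?(ltW hi0) //; exact: pair_Y_ge0.
  + by rewrite /X scalerBr opprB scalemx1.
  + move=> z /eigenvalueP[v vY v0].
    have vYE : v *m cplx_mx Y = ((h%:C)%C * z) *: v.
      rewrite -scalerA -vY scalemxAr; congr (_ *m _); apply/matrixP => i j.
      by rewrite !mxE -rmorphM mulVKf.
    have /Y1 : eigenvalue (cplx_mx Y) ((h%:C)%C * z) by apply/eigenvalueP; exists v.
    rewrite normrM gtr0_norm // fmorphV => hz.
    by rewrite -[leRHS]mul1r ler_pdivlMr // mulrC.
- move=> i j ij; split; last 2 first.
  + by [].
  + by rewrite mxE eqxx mulr1n.
  split; [exact: Y_subfree | by [] |].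
  have -> : meval env (MOpp (MId m)) i j = 0 by rewrite /= !mxE (negPf ij) oppr0.
  by rewrite mulr0.
Qed.

End SubFree.

(** * The transformed coefficients *)

(** The set [E] consists of the phases of [E2]; they are the phases below [m] with
    [V j j = 0].  The bound on [h] is what makes the diagonal of [C] nonnegative. *)
Lemma brownian_level_blocks (R : realType) m k (A B C V D Q : 'M[R]_(m + k)) (h : R) :
  shifted_columns A B C V D Q h ->
  is_diag_mx V -> is_diag_mx D -> rate_matrix Q -> mx_ge0 V -> 0 < h ->
  (forall j, V (lshift k j) (lshift k j) = 0 -> 0 < D (lshift k j) (lshift k j)) ->
  (forall j, D (rshift m j) (rshift m j) < 0) ->
  (forall j, 0 <= (h ^- 2 *: V + h^-1 *: D + Q) (lshift k j) (lshift k j)) ->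
  level_blocks A B C (fun j => (j < m)%N && (V j j == 0)).
Proof.
move=> cols /is_diag_mxP V_diag /is_diag_mxP D_diag [Q0 Q1] V0 h0.
move=> V_eq0 D_lt0 hsmall; have [A_l A_r B_l B_r C_l C_r _] := cols.
have El (M : 'M[R]_(m + k)) N : lsubmx M = N -> forall i j, M i (lshift k j) = N i j.
  by move=> <- i j; rewrite mxE.
have Er (M : 'M[R]_(m + k)) N : rsubmx M = N -> forall i j, M i (rshift m j) = N i j.
  by move=> <- i j; rewrite mxE.
have hi0 : 0 < h^-1 by rewrite invr_gt0.
have hi2 : 0 < h ^- 2 by rewrite invr_gt0 exprn_gt0.
have AlE i j : A i (lshift k j) = h ^- 2 * V i (lshift k j) by rewrite (El _ _ A_l) !mxE.
have ArE i j : A i (rshift m j) = - (h^-1 * D i (rshift m j)).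
  by rewrite (Er _ _ A_r) !mxE.
have BlE i j : B i (lshift k j)
    = 2 * (h ^- 2 * V i (lshift k j)) + h^-1 * D i (lshift k j).
  by rewrite (El _ _ B_l) !mxE.
have BrE i j : B i (rshift m j) = - (h^-1 * D i (rshift m j)) - Q i (rshift m j).
  by rewrite (Er _ _ B_r) !mxE.
have ClE i j : C i (lshift k j)
    = h ^- 2 * V i (lshift k j) + h^-1 * D i (lshift k j) + Q i (lshift k j).
  by rewrite (El _ _ C_l) !mxE.
have CrE i j : C i (rshift m j) = 0 by rewrite (Er _ _ C_r) mxE.
have V_off i j : i != j -> V i j = 0 by move=> ij; exact: V_diag.
have D_off i j : i != j -> D i j = 0 by move=> ij; exact: D_diag.
have A_off i j : i != j -> A i j = 0.
  case: (split_ordP j) => l -> ij.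
    by rewrite AlE V_off ?mulr0.
  by rewrite ArE D_off ?mulr0 ?oppr0.
have Adiag_r j : 0 < A (rshift m j) (rshift m j).
  by rewrite ArE oppr_gt0 pmulr_rlt0.
split.
- move=> i j; have [->|/A_off -> //] := eqVneq i j.
  case: (split_ordP j) => l ->; first by rewrite AlE mulr_ge0 // ltW.
  exact: ltW.
- exact: A_off.
- move=> j; case: (split_ordP j) => l ->; last by move=> _; exact: Adiag_r.
  move=> Vl; rewrite AlE mulr_gt0 // lt_neqAle eq_sym Vl.
  exact: V0.
- move=> j; case: (split_ordP j) => l -> //.
  by move=> /andP[_ /eqP Vl]; rewrite AlE Vl mulr0.
- move=> i j ij; case: (split_ordP j) ij => l -> ij.
    by rewrite BlE V_off // D_off // !mulr0 addr0.
  by rewrite BrE D_off // mulr0 oppr0 sub0r oppr_le0 Q0.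
- move=> i j; case: (split_ordP j) => l -> //.
  by move=> _ ij; rewrite BlE V_off // D_off // !mulr0 addr0.
- move=> j; case: (split_ordP j) => l -> //.
  by move=> /andP[_ /eqP Vl]; rewrite BlE Vl !mulr0 add0r mulr_gt0 // V_eq0.
- move=> i j; case: (split_ordP j) => l ->; last by rewrite CrE.
  rewrite ClE; have [->|il] := eqVneq i (lshift k l).
    by have := hsmall l; rewrite !mxE.
  by rewrite V_off // D_off // !mulr0 !add0r Q0.
- apply/eqP; rewrite eq_sym -subr_eq0 -mulmxBl addrAC.
  by rewrite (shifted_generator cols) Q1.
Qed.

Section Blocks.
Variables (R : pzRingType) (n1 n2 n3 : nat).

Lemma block3_mxK (M : 'M[R]_(n1 + n2 + n3)) : M = block3_mx (blk11 M) (blk12 M) (blk13 M)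
  (blk21 M) (blk22 M) (blk23 M) (blk31 M) (blk32 M) (blk33 M).
Proof.
rewrite /block3_mx /blk11 /blk12 /blk13 /blk21 /blk22 /blk23 /blk31 /blk32 /blk33.
by rewrite submxK vsubmxK hsubmxK submxK.
Qed.

Lemma lsub_block3 M11 M12 M13 M21 M22 M23 M31 M32 M33 :
  lsubmx (@block3_mx R n1 n2 n3 M11 M12 M13 M21 M22 M23 M31 M32 M33)
  = col_mx (block_mx M11 M12 M21 M22) (row_mx M31 M32).
Proof. by rewrite /block3_mx block_mxEh row_mxKl. Qed.

Lemma rsub_block3 M11 M12 M13 M21 M22 M23 M31 M32 M33 :
  rsubmx (@block3_mx R n1 n2 n3 M11 M12 M13 M21 M22 M23 M31 M32 M33)
  = col_mx (col_mx M13 M23) M33.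
Proof. by rewrite /block3_mx block_mxEh row_mxKr. Qed.

Lemma diag_block3 (M : 'M[R]_(n1 + n2 + n3)) :
  is_diag_mx M -> M = block3_mx (blk11 M) 0 0 0 (blk22 M) 0 0 0 (blk33 M).
Proof.
move=> /is_diag_mxP dM; rewrite {1}[M]block3_mxK; congr block3_mx;
  apply/matrixP => i j; rewrite !mxE dM //= ?addnA; apply/eqP => e.
all: have := ltn_ord i; have := ltn_ord j; lia.
Qed.

End Blocks.

Lemma tilde_columns (R : realType) n1 n2 n3 (V D Q : 'M[R]_(n1 + n2 + n3)) (h : R) :
  is_diag_mx V -> is_diag_mx D -> blk22 V = 0 -> blk33 V = 0 ->
  shifted_columns (Atilde V D h) (Btilde V D Q h) (Ctilde V D Q h) V D Q h.
Proof.
move=> V_diag D_diag V22 V33.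
have lV : lsubmx V = col_mx (block_mx (blk11 V) 0 0 0) (row_mx 0 0).
  by rewrite {1}(diag_block3 V_diag) lsub_block3 V22.
have rV : rsubmx V = col_mx (col_mx 0 0) 0.
  by rewrite {1}(diag_block3 V_diag) rsub_block3 V33.
have lD : lsubmx D = col_mx (block_mx (blk11 D) 0 0 (blk22 D)) (row_mx 0 0).
  by rewrite {1}(diag_block3 D_diag) lsub_block3.
have rD : rsubmx D = col_mx (col_mx 0 0) (blk33 D).
  by rewrite {1}(diag_block3 D_diag) rsub_block3.
have lQ : lsubmx Q = col_mx (block_mx (blk11 Q) (blk12 Q) (blk21 Q) (blk22 Q))
                            (row_mx (blk31 Q) (blk32 Q)).
  by rewrite {1}[Q]block3_mxK lsub_block3.
have rQ : rsubmx Q = col_mx (col_mx (blk13 Q) (blk23 Q)) (blk33 Q).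
  by rewrite {1}[Q]block3_mxK rsub_block3.
split; rewrite ?lV ?rV ?lD ?rD ?lQ ?rQ.
all: rewrite ?(lsub_block3, rsub_block3).
all: rewrite ?(scale_col_mx, scale_row_mx, scale_block_mx, scaler0, opp_col_mx, oppr0).
all: rewrite ?(add_col_mx, add_row_mx, add_block_mx, addr0, add0r).
all: by rewrite /block_mx ?row_mx0 ?col_mx0.
Qed.

(** * Stable invariant pairs *)

Theorem theorem13 (R : realType) (n1 n2 n3 : nat)
    (V D Q : 'M[R]_(n1 + n2 + n3)) (h : R) (u : 'rV[R]_(n1 + n2 + n3))
    (V_diag : is_diag_mx V) (V_ge0 : mx_ge0 V) (D_diag : is_diag_mx D)
    (Q_rate : rate_matrix Q) (Q_irr : mx_irreducible Q)
    (Q_aper : mx_aperiodic Q) (V_neq0 : V != 0)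
    (VD_neq0 : forall i, ~ (V i i = 0 /\ D i i = 0))
    (E1_def : E1 V = [set i : 'I_(n1 + n2 + n3) | (i < n1)%N])
    (E2_def : E2 V D = [set i : 'I_(n1 + n2 + n3) | (n1 <= i < n1 + n2)%N])
    (E3_def : E3 V D = [set i : 'I_(n1 + n2 + n3) | (n1 + n2 <= i)%N])
    (h_gt0 : 0 < h)
    (h_small1 : forall i,
       0 <= (h ^- 2 *: blk11 V + h^-1 *: blk11 D + blk11 Q) i i)
    (h_small2 : forall i, 0 <= (h^-1 *: blk22 D + blk22 Q) i i)
    (u_gt0 : mx_gt0 u) (uQ : u *m Q = 0) :
  let n := (n1 + n2 + n3)%N in
  let A := Atilde V D h in
  let B := Btilde V D Q h in
  let C := Ctilde V D Q h in
  let d := (u *m D *m ones R n) 0 0 in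
  let d' := (u *m (C - A) *m ones R n) 0 0 in
  let P := [:: cplx_mx Q; - cplx_mx D; cplx_mx V] in
  let F := [:: cplx_mx C; - cplx_mx B; cplx_mx A] in
  let Bh := Bhat_inf A B C in
  let B11 := ulsubmx Bh in let B12 := ursubmx Bh in
  let B21 := dlsubmx Bh in let B22 := drsubmx Bh in
  let C11 := ulsubmx C in let C21 := dlsubmx C in
  let Psi := - (B12 *m invmx B22) in
  let S := B11 + Psi *m B21 in
  let Y := (C11 + Psi *m C21) *m invmx S in
  let X := h^-1 *: (Y - 1%:M) in
  let U := row_mx 1%:M Psi in
  let env := cr_env Bh (Bhat_inf_w A B C) C h in
  let known := @cr_known n in
  [/\ mx_ge0 Psi /\ mx_ge0 Y,
      d_stable n3 d' F (cplx_mx Y) (cplx_mx U),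
      c_stable (n1 + n2) d P (cplx_mx X) (cplx_mx U),
      subfree_expr env known (IPsi_e (n1 + n2) n3) U /\
      subfree_expr env known (Y_e (n1 + n2) n3) Y
    & subfree_offdiag_expr env known (X_e (n1 + n2) n3) X].
Proof.
move=> n A B C d d' P F Bh B11 B12 B21 B22 C11 C21 Psi S Y X U env known.
have V_E1 (i : 'I_n) : (i < n1)%N -> 0 < V i i.
  by move=> i1; have /setP/(_ i) := E1_def; rewrite !inE i1.
have VD_E2 (i : 'I_n) : (n1 <= i < n1 + n2)%N -> V i i = 0 /\ 0 < D i i.
  by move=> i2; have /setP/(_ i) := E2_def; rewrite !inE i2 => /andP[/eqP].
have VD_E3 (i : 'I_n) : (n1 + n2 <= i)%N -> V i i = 0 /\ D i i < 0.
  by move=> i3; have /setP/(_ i) := E3_def; rewrite !inE i3 => /andP[/eqP].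
have V22 : blk22 V = 0.
  apply/matrixP => i j; rewrite !mxE; have [->|ij] := eqVneq i j.
    by apply: (VD_E2 _ _).1; rewrite /= leq_addr ltn_add2l ltn_ord.
  by apply: (is_diag_mxP V_diag); rewrite /= eqn_add2l.
have V33 : blk33 V = 0.
  apply/matrixP => i j; rewrite !mxE; have [->|ij] := eqVneq i j.
    by apply: (VD_E3 _ _).1; rewrite /= leq_addr.
  by apply: (is_diag_mxP V_diag); rewrite /= eqn_add2l.
have cols := tilde_columns Q h V_diag D_diag V22 V33.
have lb : level_blocks A B C (fun j => (j < n1 + n2)%N && (V j j == 0)).
  apply: brownian_level_blocks cols _ _ _ _ _ _ _ _ => //.
  - move=> j V0; apply: (VD_E2 _ _).2; rewrite /= ltn_ord andbT leqNgt.
    by apply/negP => /(V_E1 (lshift n3 j)); rewrite V0 ltxx.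
  - by move=> j; apply: (VD_E3 _ _).2; rewrite /= leq_addr.
  - move=> j; case: (split_ordP j) => l ->.
      by have := h_small1 l; rewrite !mxE.
    have := h_small2 l; rewrite !mxE (VD_E2 (lshift n3 (rshift n1 l)) _).1.
      by rewrite mulr0 add0r.
    by rewrite /= leq_addr ltn_add2l ltn_ord.
have notE : exists i : 'I_n, ~~ ((i < n1 + n2)%N && (V i i == 0)).
  have : ~~ [forall i, V i i == 0].
    apply: contra V_neq0 => /forallP V0; apply/eqP/matrixP => i j; rewrite mxE.
    have [<-|ij] := eqVneq i j; first exact/eqP.
    exact: (is_diag_mxP V_diag).
  by move=> /forallPn[i Vi]; exists i; rewrite negb_and Vi orbT.
have [s [Ys s1]] := pair_spectrum lb cols u_gt0 Q_irr uQ notE.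
have [_ Psi_ge0 _] := pair_signs lb.
have d'E : d' = h^-1 * d by exact: drift_shift cols uQ.
have d_lt0 : (d' < 0) = (d < 0) by rewrite d'E pmulr_rlt0 // invr_gt0.
have freeU : row_free U := U_free A B C.
have Re1 z : `|z| < 1 -> complex.Re z < 1 :> R.
  by rewrite normcC ltcR; apply: le_lt_trans; exact: Re_le_normc.
set t := (if _ then s else _) in Ys.
have size_t : size t = (n1 + n2)%N.
  by have := size_char_poly (cplx_mx Y); rewrite (Ys : _ = _) size_prod_XsubC => -[].
have t_le1 z : z \in t -> `|z| <= 1.
  rewrite /t; case: ifP => _; first by move=> /s1/ltW.
  by rewrite inE => /predU1P[->|/s1/ltW //]; rewrite normr1.
split.
- by split=> //; exact: pair_Y_ge0 lb.
- split.
    rewrite /F -[- cplx_mx B]map_mxN; apply: left_invariant_pair2 => //.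
    exact: pair_F lb cols.
  (* The eigenvalues of [F] that [Y] lacks are the [n3] zeros of [y ^ n3]. *)
  exists (s ++ nseq n3 0), t; split=> //.
  + move: size_t; rewrite size_cat size_nseq /t -/d'.
    by case: ifP => _ /= <-; rewrite // addSn.
  + move=> z; case: ifPn => z1.
      have zne1 : z != 1 by apply: contraTneq z1 => ->; rewrite normr1 ltxx.
      rewrite (count_F lb cols Ys (Re1 _ z1)) /t -/d'.
      by case: ifP => //= _; rewrite eq_sym (negPf zne1).
    apply/count_memPn; rewrite mem_cat mem_nseq negb_or negb_and.
    apply/andP; split; first by apply: contra z1 => /s1.
    by apply/orP; right; apply: contra z1 => /eqP->; rewrite normr0 ltr01.
  + by rewrite /t -/d'; case: ifP.
- split.
    rewrite /P -[- cplx_mx D]map_mxN; apply: left_invariant_pair2 => //.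
    exact: pair_P lb h_gt0 cols.
  pose f (z : R[i]) := (z - 1) / (h%:C)%C.
  have hC : 0 < (h%:C)%C :> R[i] by rewrite ltcR.
  have Ref z : z \in s -> complex.Re (f z) < 0.
    move=> /s1/Re1; rewrite /f -fmorphV mulrC; case: z => a b /= a1.
    by rewrite mul0r subr0 pmulr_rlt0 ?invr_gt0 // subr_lt0.
  exists (map f s); split.
  + by move: size_t; rewrite size_map /t -/d' d_lt0; case: ifP => //= _ <-.
  + move=> z; case: ifPn => z0.
      rewrite (count_P lb h_gt0 cols Ys z0) /t -/d'.
      case: ifP => //= _; rewrite subrr mul0r.
      by have [e|] := eqVneq 0 z; rewrite // -e /= ltxx in z0.
    by apply/count_memPn; apply: contra z0 => /mapP[y ys ->]; exact: Ref.
  + have := X_eigenvalues h_gt0 Ys; rewrite /t -/d' d_lt0.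
    by case: ifP => //= _; rewrite subrr mul0r.
- by split; [exact: IPsi_subfree lb | exact: Y_subfree_expr lb].
- apply: X_subfree_expr lb h_gt0 _ => z.
  by rewrite eigenvalue_root_char (Ys : _ = _) root_prod_XsubC; exact: t_le1.
Qed.
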